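(* Let $f:\Omega\times\mathbb R\to\mathbb R$ satisfy the structural assumption (A) stated in the context. Assume in addition that $f$ satisfies the growth condition: there exists $c\in(0,1]$ such that $c|f(x,\xi-\eta)|\le|f(x,\xi)-f(x,\eta)|$ for a.e. $x\in\Omega$ and all $\xi,\eta\in\mathbb R$; and that $f(\cdot,w(\cdot))\in L^2(\Omega)$ for every $w\in L^\infty(\Omega)$. Let (i) $J_1:L^2(\Omega)\to[0,+\infty]$ be proper and lower semicontinuous; (ii) $J_2:L^2(\Omega)\to(-\infty,+\infty]$ be proper, convex, lower semicontinuous and bounded from below. Let $z_a,z_b\in L^\infty(\Omega)$ with $z_a\le z_b$ a.e. in $\Omega$ and $Z_{ad}=\{z\in L^\infty(\Omega): z_a\le z\le z_b\text{ a.e. in }\Omega\}$. Then the minimization problem $$\min_{z\in Z_{ad}}\mathcal J(z):=J_1(S(z))+J_2(z)$$ admits a solution, where $S(z)=u$ denotes the unique weak solution of $(L_D)^su+f(x,u)=z$ in $\Omega$.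
   Context: Setting. $N\ge 1$, $0<s<1$, and $\Omega\subset\mathbb R^N$ is an arbitrary bounded open set. The coefficients $a_{ij}\in L^\infty(\Omega)$ are real, measurable, symmetric ($a_{ij}=a_{ji}$ a.e.) and elliptic: there is $\gamma>0$ with $\sum_{i,j}a_{ij}(x)\xi_i\xi_j\ge\gamma|\xi|^2$ for all $\xi\in\mathbb R^N$ and a.e. $x\in\Omega$. $L_D$ is the positive self-adjoint operator on $L^2(\Omega)$ associated with the closed form $\mathcal E_D(u,v)=\sum_{i,j}\int_\Omega a_{ij}D_iu\,D_jv\,dx$, $u,v\in H^1_0(\Omega)$. It has compact resolvent, eigenvalues $0<\lambda_1\le\lambda_2\le\cdots\to\infty$ and an orthonormal basis of eigenfunctions $(\varphi_n)$ of $L^2(\Omega)$. For $\theta\ge0$, $\mathbb H^\theta(\Omega)=\{u\in L^2(\Omega):\|u\|^2_{\mathbb H^\theta(\Omega)}:=\sum_n\lambda_n^\theta u_n^2<\infty\}$, with $u_n=\int_\Omega u\varphi_n\,dx$. Powers are defined spectrally, $(L_D)^{\alpha}u=\sum_n\lambda_n^{\alpha}u_n\varphi_n$, so $\|u\|_{\mathbb H^s(\Omega)}=\|(L_D)^{s/2}u\|_{L^2(\Omega)}$. Assumption (A) on $f$. For a.e. $x\in\Omega$: $f(x,\cdot)$ is odd, strictly increasing, continuous, $f(x,0)=0$, and $\lim_{t\to\infty}f(x,t)=\infty$; for all $t$, $f(\cdot,t)$ is measurable. Let $\widetilde f(x,\cdot)$ be the inverse of $f(x,\cdot)$, $F(x,t)=\int_0^{|t|}f(x,\tau)\,d\tau$,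 $\widetilde F(x,t)=\int_0^{|t|}\widetilde f(x,\tau)\,d\tau$. There are constants $c_1,c_2\in(0,1]$ independent of $x$ such that for a.e. $x\in\Omega$ and all $t\in\mathbb R$: $c_1tf(x,t)\le F(x,t)\le tf(x,t)$ and $c_2t\widetilde f(x,t)\le\widetilde F(x,t)\le t\widetilde f(x,t)$. Space and weak solutions. $\mathcal V_0=\{u\in\mathbb H^s(\Omega):F(\cdot,u(\cdot))\in L^1(\Omega)\}$. A weak solution of $(L_D)^su+f(x,u)=z$, for $z\in L^\infty(\Omega)$, is $u\in\mathcal V_0$ with $\int_\Omega(L_D)^{s/2}u\,(L_D)^{s/2}v\,dx+\int_\Omega f(x,u)v\,dx=\int_\Omega zv\,dx$ for all $v\in\mathcal V_0$. Under (A) the weak solution exists, is unique, and belongs to $\mathbb H^s(\Omega)\cap L^\infty(\Omega)$, so $S$ is well defined on $L^\infty(\Omega)$. *)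

(* Defs.v *)
From HB Require Import structures.
From mathcomp Require Import all_boot all_order all_algebra.
From mathcomp Require Import all_classical all_reals all_analysis.
From mathcomp Require Import measurable_realfun.
Set Implicit Arguments.
Unset Strict Implicit.
Unset Printing Implicit Defensive.
Import Order.TTheory GRing.Theory Num.Theory.
Import numFieldNormedType.Exports.
Local Open Scope classical_set_scope.
Local Open Scope ring_scope.

(* R^N is 'rV[R]_n.+1, i.e. N = n.+1 (so that N >= 1).                        *)

Section lebesgue_on.
Local Open Scope ereal_scope.
Context {R : realType} {n : nat}.
Implicit Types (b : 'rV[R]_n.+1 * 'rV[R]_n.+1) (A Omega : set 'rV[R]_n.+1).

Definition box b : set 'rV[R]_n.+1 :=
  [set x | forall i, (b.1 ord0 i < x ord0 i <= b.2 ord0 i)%R].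

Definition box_volume b : \bar R :=
  (\prod_(i < n.+1) Num.max 0 (b.2 ord0 i - b.1 ord0 i))%R%:E.

Lemma box_volume_ge0 b : 0 <= box_volume b.
Proof. by rewrite lee_fin; apply: prodr_ge0 => i _; rewrite le_max lexx. Qed.

Definition box_cover A : set (nat -> 'rV[R]_n.+1 * 'rV[R]_n.+1) :=
  [set C | A `<=` \bigcup_k box (C k)].

(* The trace on Omega of the Lebesgue outer measure: A |-> |A `&` Omega|^*.   *)
Definition lebesgue_outer Omega A : \bar R :=
  ereal_inf [set \sum_(k <oo) box_volume (C k) | C in box_cover (A `&` Omega)].

Lemma lebesgue_outer_ge0 Omega A : 0 <= lebesgue_outer Omega A.
Proof.
apply: le_ereal_inf_tmp => _ [C _ <-].
by apply: nneseries_ge0 => k _ _; exact: box_volume_ge0.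
Qed.

Lemma le_lebesgue_outer Omega :
  {homo lebesgue_outer Omega : A B / A `<=` B >-> A <= B}.
Proof.
move=> A B AB; apply/ereal_inf_le_tmp => _ [C BC <-]; exists C => //.
by move=> x [Ax Ox]; apply: BC; split => //; exact: AB.
Qed.

Lemma lebesgue_outer0 Omega : lebesgue_outer Omega set0 = 0.
Proof.
apply/eqP; rewrite eq_le lebesgue_outer_ge0 andbT.
apply: ereal_inf_lbound; exists (fun=> (0, 0)%R) => /=; first by move=> x [].
apply: eseries0 => k _ _; rewrite /box_volume big_ord_recl/=.
by rewrite !mxE subrr maxxx mul0r.
Qed.

Lemma lebesgue_outer_sigma_subadditive Omega :
  sigma_subadditive (lebesgue_outer Omega).
Proof.
move=> A.
have [[i ioo]|] := pselect (exists i, lebesgue_outer Omega (A i) = +oo).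
  rewrite (eseries_pinfty _ _ ioo) ?leey// => k _.
  by rewrite -ltNye (lt_le_trans _ (lebesgue_outer_ge0 _ _)).
rewrite -forallNE => Aoo.
suff add2e (e : {posnum R}) : lebesgue_outer Omega (\bigcup_k A k) <=
    \sum_(i <oo) lebesgue_outer Omega (A i) + e%:num%:E.
  by apply/lee_addgt0Pr => _/posnumP[].
rewrite (le_trans _ (epsilon_trick _ _ _))//; last first.
  by move=> k; exact: lebesgue_outer_ge0.
pose P k C := box_cover (A k `&` Omega) C /\
  \sum_(j <oo) box_volume (C j) <=
  lebesgue_outer Omega (A k) + (e%:num / (2 ^ k.+1)%:R)%:E.
have [G PG] : {G : nat -> nat -> _ & forall k, P k (G k)}.
  apply: (@choice _ _ P) => k; rewrite /P /lebesgue_outer.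
  set S := (X in ereal_inf X); move infS : (ereal_inf S) => iS.
  case: iS infS => [r Sr|Soo|Soo].
  - have en1 : (0 < e%:num / (2 ^ k.+1)%:R)%R by [].
    have /(lb_ereal_inf_adherent en1) : ereal_inf S \is a fin_num by rewrite Sr.
    move=> [x [C AC muCx] xS].
    by exists C; split => //; rewrite muCx -Sr; exact/ltW.
  - by have := Aoo k; rewrite /lebesgue_outer Soo.
  - suff : lbound S 0 by move/le_ereal_inf_tmp; rewrite Soo.
    move=> /= _ [C _ <-].
    by apply: nneseries_ge0 => j _ _; exact: box_volume_ge0.
have muG_ge0 x : 0 <= (box_volume \o uncurry G) x by exact: box_volume_ge0.
apply: (@le_trans _ _ (\esum_(i in setT) (box_volume \o uncurry G) i)).
  rewrite /lebesgue_outer; apply: ereal_inf_lbound => /=.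
  have /card_esym/ppcard_eqP[f] := card_nat2.
  exists (uncurry G \o f).
    move=> t [[i _ Ait] Ot].
    have [j _ Gijt] := (PG i).1 _ (conj Ait Ot).
    by exists (f^-1%FUN (i, j)) => //=; rewrite invK ?inE.
  rewrite -(esum_pred_image (box_volume \o uncurry G) _ xpredT)
    ?[fun=> _]set_true//.
  by rewrite image_eq.
rewrite (_ : esum _ _ =
    \sum_(i <oo) \sum_(j <oo) box_volume (G i j)); last first.
  pose J : nat -> set (nat * nat) := fun i => [set (i, j) | j in setT].
  rewrite (_ : [set: nat * nat] = \bigcup_k J k); last first.
    by rewrite predeqE => -[a b]; split => // _; exists a => //; exists b.
  rewrite esum_bigcupT /=; last 2 first.
    - apply/trivIsetP => i j _ _ ij.
      rewrite predeqE => -[k m] /=; split => //= -[] [_] _ [<-{k} _].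
      by move=> [m' _] [] /esym/eqP; rewrite (negbTE ij).
    - by move=> /= [k m]; exact: box_volume_ge0.
  rewrite -(image_id [set: nat]) -fun_true esum_pred_image//; last first.
    by move=> k _; apply: esum_ge0 => m _; exact: box_volume_ge0.
  apply: eq_eseriesr => /= j _.
  rewrite -(esum_pred_image (box_volume \o uncurry G) (pair j) predT)/=;
    [|by move=> m _; exact: box_volume_ge0
     |by move=> ? ? _ _; exact: (@can_inj _ _ _ snd)].
  by congr esum; rewrite predeqE => -[a b]; split; move=> [i _ <-]; exists i.
apply: lee_lim.
- apply: is_cvg_nneseries => k *.
  by apply: nneseries_ge0 => m *; exact: (muG_ge0 (k, m)).
- by apply: is_cvg_nneseries => k *; apply: adde_ge0 => //;
    exact: lebesgue_outer_ge0.
- by near=> k; apply: lee_sum => i _; exact: (PG i).2.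
Unshelve. all: by end_near. Qed.

HB.instance Definition _ Omega := isOuterMeasure.Build R 'rV[R]_n.+1
  (lebesgue_outer Omega) (lebesgue_outer0 Omega) (lebesgue_outer_ge0 Omega)
  (@le_lebesgue_outer Omega) (@lebesgue_outer_sigma_subadditive Omega).

(* The points of R^N with the sigma-algebra of the sets whose trace on Omega  *)
(* is Lebesgue measurable (Omega being Lebesgue measurable, e.g. open), and   *)
(* the Lebesgue measure restricted to Omega: the complement of Omega is null. *)
(* Hence functions on Omega are represented by functions on R^N whose values  *)
(* outside Omega are irrelevant.                                              *)
Definition domain Omega := caratheodory_type (lebesgue_outer Omega).

HB.instance Definition _ Omega := Measurable.on (domain Omega).

Definition lebesgue_on Omega : set (domain Omega) -> \bar R :=
  lebesgue_outer Omega.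

HB.instance Definition _ Omega := isMeasure.Build _ _ _ (@lebesgue_on Omega)
  (@caratheodory_measure0 _ _ (lebesgue_outer Omega))
  (@caratheodory_measure_ge0 _ _ (lebesgue_outer Omega))
  (@caratheodory_measure_sigma_additive _ _ (lebesgue_outer Omega)).

End lebesgue_on.
Arguments domain {R n} Omega.
Arguments lebesgue_on {R n} Omega.

Section L2.
Context {R : realType} {n : nat} (Omega : set 'rV[R]_n.+1).
Local Notation mu := (lebesgue_on Omega).
Implicit Types u v : domain Omega -> R.

Definition L2norm u : \bar R := ('N[mu]_(2%:E)[EFin \o u])%E.

Definition L2dot u v : R := \int[mu]_x (u x * v x).

Definition L2 : Type := LspaceType2 mu.
HB.instance Definition _ := gen_eqMixin L2.
HB.instance Definition _ := gen_choiceMixin L2.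
Definition L2fun (u : L2) : domain Omega -> R := (u : LspaceType2 mu).
Coercion L2fun : L2 >-> Funclass.

Lemma measurable_L2fun (u : L2) :
  measurable_fun [set: domain Omega] (u : domain Omega -> R).
Proof.
exact: (@measurable_funPT _ _ (domain Omega) (measurableTypeR R)
  (repr (LebesgueSpace.sort u))).
Qed.

Definition L2ball (u : L2) (e : R) : set L2 := 
  [set v : L2 | (L2norm (v \- u)%R < e%:E)%E].

Definition L2nbhs (u : L2) : set_system L2 :=
  filter_from [set e | 0 < e] (L2ball u).

Lemma L2ball_triangle (u v w : L2) (d e : R) :
  L2ball u d v -> L2ball v e w -> L2ball u (d + e) w.
Proof.
rewrite /L2ball/= => uv vw.
have -> : (w : domain Omega -> R) \- u = (w \- v) \+ (v \- u).
  by apply/funext => x /=; rewrite subrKA.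
rewrite EFinD addeC (le_lt_trans _ (lteD vw uv))//.
by apply: eminkowski; rewrite ?lee1n//; apply: measurable_funB;
  exact: measurable_L2fun.
Qed.

Lemma L2ball_center (u : L2) (e : R) : 0 < e -> L2ball u e u.
Proof.
move=> e0; rewrite /L2ball/= /L2norm.
rewrite (_ : EFin \o _ = cst 0%E); first by rewrite Lnorm0// eqe.
by apply/funext => x /=; rewrite subrr.
Qed.

Lemma L2nbhs_filter (u : L2) : ProperFilter (L2nbhs u).
Proof.
apply: filter_from_proper; last first.
  by move=> e e0; exists u; exact: L2ball_center.
apply: filter_from_filter; first by exists 1 => /=.
move=> d e /= d0 e0; exists (Num.min d e); first by rewrite /= lt_min d0.
by move=> v /= uv; split; apply: lt_le_trans uv _;
  rewrite lee_fin ge_min lexx ?orbT.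
Qed.

Lemma L2nbhs_singleton (u : L2) (A : set L2) : L2nbhs u A -> A u.
Proof. by move=> [e /= e0]; apply; exact: L2ball_center. Qed.

Lemma L2nbhs_nbhs (u : L2) (A : set L2) : L2nbhs u A -> L2nbhs u (L2nbhs^~ A).
Proof.
move=> [e /= e0 eA]; exists (e / 2); first by rewrite /= divr_gt0.
move=> v uv; exists (e / 2); first by rewrite /= divr_gt0.
by move=> w vw; apply: eA; rewrite [e]splitr; exact: L2ball_triangle vw.
Qed.

HB.instance Definition _ := hasNbhs.Build L2 L2nbhs.
HB.instance Definition _ := Nbhs_isNbhsTopological.Build L2
  L2nbhs_filter L2nbhs_singleton L2nbhs_nbhs.

Definition convex_functional (J : L2 -> \bar R) := forall (u v w : L2) (t : R),
  0 <= t <= 1 -> (\forall x \ae mu, w x = t * u x + (1 - t) * v x) ->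
  (J w <= t%:E * J u + (1 - t)%:E * J v)%E.

Definition proper_functional (J : L2 -> \bar R) := exists u : L2, (J u < +oo)%E.

End L2.
Arguments L2norm {R n Omega} u.
Arguments L2dot {R n Omega} u v.

Section sobolev.
Context {R : realType} {n : nat} (Omega : set 'rV[R]_n.+1).
Local Notation mu := (lebesgue_on Omega).
Implicit Types (p : 'rV[R]_n.+1 -> R) (u v w g : domain Omega -> R).

Definition partial (i : 'I_n.+1) p : 'rV[R]_n.+1 -> R :=
  fun x => 'D_(delta_mx ord0 i) p x.

Definition smooth p := forall s : seq 'I_n.+1,
  continuous (foldr partial p s) /\
  forall i x, derivable (foldr partial p s) x (delta_mx ord0 i).

(* p belongs to C_c^oo(Omega) *)
Definition test_function p := smooth p /\
  exists K, [/\ compact K, K `<=` Omega & forall x, ~ K x -> p x = 0].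

Definition weak_partial (i : 'I_n.+1) u g := forall p, test_function p ->
  L2dot u (partial i p : domain Omega -> R) = - L2dot g (p : domain Omega -> R).

Definition H1 : set (domain Omega -> R) := [set u | u \in Lfun mu 2%:E /\
  forall i, exists2 g, g \in Lfun mu 2%:E & weak_partial i u g].

Definition weak_derivative (i : 'I_n.+1) u : domain Omega -> R :=
  xget (cst 0) [set g | g \in Lfun mu 2%:E /\ weak_partial i u g].

(* the closure of C_c^oo(Omega) in H^1(Omega) *)
Definition H10 : set (domain Omega -> R) := [set u | H1 u /\
  forall e : R, 0 < e -> exists p, [/\ test_function p,
    (L2norm (u \- (p : domain Omega -> R))%R < e%:E)%E &
    forall i, (L2norm (weak_derivative i u \-
      (partial i p : domain Omega -> R))%R < e%:E)%E]].

Variable a : 'I_n.+1 -> 'I_n.+1 -> domain Omega -> R.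

Definition elliptic_coefficients :=
  [/\ forall i j, a i j \in Lfun mu +oo%E,
      forall i j, \forall x \ae mu, a i j x = a j i x &
      exists2 gamma : R, 0 < gamma & \forall x \ae mu, forall xi : 'rV[R]_n.+1,
        gamma * (\sum_i xi ord0 i ^+ 2) <=
        \sum_i \sum_j a i j x * xi ord0 i * xi ord0 j].

Definition energy u v : R := \sum_i \sum_j
  \int[mu]_x (a i j x * weak_derivative i u x * weak_derivative j v x).

(* the graph of the operator L_D associated with the form: L_D u = w *)
Definition LD u w := [/\ H10 u, w \in Lfun mu 2%:E &
  forall v, H10 v -> energy u v = L2dot w v].

(* an orthonormal basis of L^2(Omega) of eigenfunctions of L_D, with the      *)
(* eigenvalues listed in nondecreasing order (numbered from 0)                *)
Definition eigenbasis (lam : nat -> R) (phi : nat -> domain Omega -> R) :=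
  [/\ forall k, LD (phi k) (fun x => lam k * phi k x),
      forall j k, L2dot (phi j) (phi k) = (j == k)%:R,
      forall u, u \in Lfun mu 2%:E ->
        L2norm (fun x => u x - \sum_(k < m) L2dot u (phi k) * phi k x)
          @[m --> \oo] --> 0%E &
      [/\ forall k, 0 < lam k, {homo lam : j k / (j <= k)%N >-> j <= k} &
          lam @ \oo --> +oo]].

End sobolev.

Section fractional_problem.
Context {R : realType} {n : nat} {Omega : set 'rV[R]_n.+1}.
Local Notation mu := (lebesgue_on Omega).
Variables (lam : nat -> R) (phi : nat -> domain Omega -> R).
Implicit Types (u v z : domain Omega -> R) (f : domain Omega -> R -> R).

Definition Hspace (theta : R) : set (domain Omega -> R) :=
  [set u | u \in Lfun mu 2%:E /\
    (\sum_(k <oo) (lam k `^ theta * L2dot u (phi k) ^+ 2)%:E < +oo)%E].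

(* (L_D)^alpha u, the sum of the series in L^2(Omega) *)
Definition LD_power (alpha : R) u : domain Omega -> R :=
  xget (cst 0) [set w | w \in Lfun mu 2%:E /\
    L2norm (fun x =>
        w x - \sum_(k < m) lam k `^ alpha * L2dot u (phi k) * phi k x)
      @[m --> \oo] --> 0%E].

Definition inverse_nonlinearity f : domain Omega -> R -> R :=
  fun x t => xget 0 [set r | f x r = t].

Definition primitive f : domain Omega -> R -> R :=
  fun x t => \int[lebesgue_measure]_(tau in `[0, `|t|]) f x tau.

Definition structural_assumption f :=
  [/\ \forall x \ae mu, [/\ (forall t, f x (- t) = - f x t) /\ f x 0 = 0,
        {homo f x : r t / r < t}, continuous (f x) &
        f x t @[t --> +oo] --> +oo],
      forall t, measurable_fun [set: domain Omega] (f^~ t) &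
      exists c : R * R, [/\ 0 < c.1 <= 1, 0 < c.2 <= 1 &
        \forall x \ae mu, forall t,
          c.1 * (t * f x t) <= primitive f x t <= t * f x t /\
          c.2 * (t * inverse_nonlinearity f x t) <=
            primitive (inverse_nonlinearity f) x t <=
            t * inverse_nonlinearity f x t]].

Definition growth_condition f := exists2 c : R, 0 < c <= 1 &
  \forall x \ae mu, forall xi eta,
    c * `|f x (xi - eta)| <= `|f x xi - f x eta|.

Definition V0 (s : R) f : set (domain Omega -> R) :=
  [set u | Hspace s u /\
    mu.-integrable [set: domain Omega] (fun x => (primitive f x (u x))%:E)].

Definition weak_solution (s : R) f z u := V0 s f u /\
  forall v, V0 s f v ->
    L2dot (LD_power (s / 2) u) (LD_power (s / 2) v) +
      \int[mu]_x (f x (u x) * v x) = L2dot z v.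

(* The control-to-state map: the weak solution with right-hand side z. The    *)
(* value where there is none (never the case for z in L^oo) is immaterial.    *)
Definition solution_map (s : R) f (z : L2 Omega) : L2 Omega :=
  xget z [set u : L2 Omega | weak_solution s f z u].

(* Z_ad, as a subset of L^2(Omega), which contains L^oo(Omega) *)
Definition admissible (za zb : domain Omega -> R) : set (L2 Omega) :=
  [set z : L2 Omega | (z : domain Omega -> R) \in Lfun mu +oo%E /\
    \forall x \ae mu, za x <= z x <= zb x].

End fractional_problem.

(* Main.v *)
(* The direct method.  Write [wt k = lam k `^ (s / 2)].  In the eigenbasis the *)
(* weak equation reads <A u, A v> + int f(x, u) v = <z, v>, where A multiplies  *)
(* the k-th coefficient by [wt k].                                             *)
(*                                                                             *)
(* Solvability: the energy |A u|^2 / 2 + int F(x, u) - <z, u> is convex and    *)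
(* coercive in A u, and its sublevel sets are closed by Fatou's lemma; convex  *)
(* subsets of L^2 which are closed, bounded, nonempty and nested have a common *)
(* point (the elements of almost minimal norm form a Cauchy sequence), so that *)
(* a minimizer exists, and it solves the Euler-Lagrange equation.  The         *)
(* condition c1 t f <= F makes F satisfy a doubling condition, so the finite   *)
(* energy functions form a vector space of admissible directions.              *)
(*                                                                             *)
(* Continuity: by monotonicity of f, |A (u - u')|^2 <= <z - z', u - u'>, and   *)
(* the right-hand side is at most (|z - z'| / wt N + C_N max_(k < N)           *)
(* |z_k - z'_k|) |A (u - u')|; as [wt N] tends to infinity, weak convergence of *)
(* bounded right-hand sides implies strong convergence of the solutions.       *)
(*                                                                             *)
(* Minimization: along an ultrafilter containing all near-minimizers, the      *)
(* coefficients of z and J2 z converge.  The nested set property, applied to   *)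
(* the z in Z_ad whose first coefficients and value of J2 are close to these   *)
(* limits, replaces both weak compactness and Mazur's lemma: it gives z in     *)
(* Z_ad with the limit coefficients and J2 z at most the limit.                *)
Require Import Defs.
From mathcomp Require Import all_boot all_order all_algebra.
From mathcomp Require Import all_classical all_reals all_analysis.
From mathcomp Require Import measurable_realfun ess_sup_inf ring lra.
Import Order.TTheory GRing.Theory Num.Theory.
Import numFieldNormedType.Exports.
Local Open Scope classical_set_scope.
Local Open Scope ring_scope.

Set Implicit Arguments.
Unset Strict Implicit.
Unset Printing Implicit Defensive.

(** * Square integrable functions *)

(** Near-minimizing controls are bounded in L^2, hence have a weak limit [V] in the admissible set.
    Being convex and lower semicontinuous, [J2] passes to weak limits. As [J1] is lower
    semicontinuous only for the norm, the solution map must turn weak convergence into norm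
    convergence. It does: the energy controls the difference of two states by the dual norm of the
    difference of the data, and for bounded data this norm depends on finitely many coefficients up
    to a small error.

    The compactness tool is [nested_convex_inter]. It yields functions with given coefficients
    ([riesz_fischer]), minimizers of the energy ([energy_minimizer]) and weak limits of controls
    ([weak_limit_exists]). From [weak_sol_exists] it follows that the states exist, and
    [weak_sol_dual_bound] carries [solution_map_continuous]. Both lower semicontinuity inequalities,
    added at [V], give at most the infimum. *)

Lemma cvg_of_geometric_steps {R : realType} (a : nat -> R) (c : R) :
  (forall k, `|a k.+1 - a k| <= c * 2^-1 ^+ k) ->
  cvgn a /\ forall k, `|limn a - a k| <= 2 * c * 2^-1 ^+ k.
Proof.
move=> ac.
have p0 k : 0 <= (2^-1 : R) ^+ k by rewrite exprn_ge0.
have c0 : 0 <= c by have := ac 0%N; rewrite expr0 mulr1; exact: le_trans.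
(* The right-hand side is the sum of [c * 2^-j] for [j] from [k] to [k + m - 1]. *)
have H k m : `|a (k + m)%N - a k| <= 2 * c * 2^-1 ^+ k - 2 * c * 2^-1 ^+ (k + m).
  elim: m => [|m IH]; first by rewrite addn0 !subrr normr0.
  rewrite addnS.
  have -> : a (k + m).+1 - a k = (a (k + m).+1 - a (k + m)%N) + (a (k + m)%N - a k).
    by rewrite subrKA.
  apply: le_trans (ler_normD _ _) _; apply: le_trans (lerD (ac _) IH) _.
  by rewrite (exprS _ (k + m)); have := p0 (k + m)%N; nra.
have H' k m : (k <= m)%N -> `|a m - a k| <= 2 * c * 2^-1 ^+ k.
  move=> km; rewrite -(subnKC km); apply: le_trans (H _ _) _.
  by rewrite gerBl mulr_ge0 // mulr_ge0.
have ca : cvgn a.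
  apply/cauchy_cvgP/cauchy_exP => e e0.
  have z : (fun k => 2 * c * 2^-1 ^+ k : R) @ \oo --> (2 * c * 0).
    by apply: cvgMr; apply: cvg_expr; rewrite ger0_norm // invf_lt1 // ltr1n.
  rewrite mulr0 in z.
  have /cvgrPdist_lt/(_ e e0)[N _ /(_ N (leqnn N))] := z.
  rewrite sub0r normrN ger0_norm ?mulr_ge0 // => HN.
  exists (a N), N => // m /= Nm; rewrite /ball /= distrC.
  exact: le_lt_trans (H' _ _ Nm) HN.
split=> // k.
have l : `|a m - a k| @[m --> \oo] --> `|limn a - a k|.
  by apply: cvg_norm; apply: cvgB => //; exact: cvg_cst.
rewrite -(cvg_lim _ l) //; apply: limr_le; first by apply/cvg_ex; eexists; exact: l.
by exists k => // m /= km; exact: H'.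
Qed.

Section square_integrable.
Context d (T : measurableType d) (R : realType).
Variable mu : {measure set T -> \bar R}.
Implicit Types u v w : T -> R.

Definition inner u v : R := \int[mu]_x (u x * v x).

Local Notation L2 := (Lfun mu 2%:E).

Lemma Lfun_measurable p u : u \in Lfun mu p -> measurable_fun [set: T] u.
Proof. by rewrite inE => /andP[/[!inE]]. Qed.

Lemma integrable_mul u v : u \in L2 -> v \in L2 ->
  mu.-integrable [set: T] (EFin \o (fun x => u x * v x)).
Proof. by move=> hu hv; apply/Lfun1_integrable; exact: Lfun2_mul_Lfun1. Qed.

Lemma EFin_inner u v : u \in L2 -> v \in L2 ->
  (\int[mu]_x (u x * v x)%:E)%E = (inner u v)%:E.
Proof.
move=> hu hv; rewrite /inner /Rintegral fineK //.
exact: (integrable_fin_num measurableT (integrable_mul hu hv)).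
Qed.

Lemma L2norm_inner u : u \in L2 ->
  ('N[mu]_(2%:E)[EFin \o u])%E = (Num.sqrt (inner u u))%:E.
Proof.
move=> hu; rewrite unlock.
have -> : (\int[mu]_x `|(EFin \o u) x| `^ 2)%E = (inner u u)%:E.
  rewrite -EFin_inner //; apply: eq_integral => x _ /=; congr EFin.
  by rewrite powR_mulrn // real_normK ?num_real // expr2.
by rewrite /= -powR12_sqrt // /inner Rintegral_ge0 // => x _; rewrite -expr2 sqr_ge0.
Qed.

Lemma Lfun2P u : measurable_fun [set: T] u ->
  mu.-integrable [set: T] (EFin \o (fun x => u x ^+ 2)) -> u \in L2.
Proof.
move=> mu_ iu; rewrite inE; apply/andP; split; rewrite inE //=.
rewrite /finite_norm unlock poweR_lty //.
have := integrable_lty measurableT iu; congr (_ < _)%E.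
apply: eq_integral => x _ /=; congr EFin.
by rewrite powR_mulrn // real_normK ?num_real.
Qed.

Lemma L2D u v : u \in L2 -> v \in L2 -> (fun x => u x + v x) \in L2.
Proof. exact: (@Lfun_addr_closed _ T R mu 2%:E (lee1n 2)).2 u v. Qed.

Lemma L2Z a u : u \in L2 -> (fun x => a * u x) \in L2.
Proof.
move=> hu; have -> : (fun x => a * u x) = a \o* u.
  by apply/funext => x /=; rewrite mulrC.
by apply: Lfun_scale => //; rewrite ler1n.
Qed.

Lemma L2B u v : u \in L2 -> v \in L2 -> (fun x => u x - v x) \in L2.
Proof.
move=> hu hv.
have -> : (fun x => u x - v x) = (fun x => u x + (-1) * v x).
  by apply/funext => x; rewrite mulN1r.
by apply: L2D => //; exact: L2Z.
Qed.

Lemma L2_0 : (fun=> 0) \in L2.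
Proof. exact: (@Lfun_addr_closed _ T R mu 2%:E (lee1n 2)).1. Qed.

Lemma L2_sum (I : Type) (r : seq I) (F : I -> T -> R) :
  (forall i, F i \in L2) -> (fun x => \sum_(i <- r) F i x) \in L2.
Proof.
move=> hF; elim: r => [|i r IH].
  have -> : (fun x => \sum_(j <- [::]) F j x) = (fun=> 0).
    by apply/funext => x; rewrite big_nil.
  exact: L2_0.
have -> : (fun x => \sum_(j <- i :: r) F j x) =
    (fun x => F i x + \sum_(j <- r) F j x).
  by apply/funext => x; rewrite big_cons.
exact: L2D.
Qed.

Lemma L2_dominated u v : measurable_fun [set: T] u -> v \in L2 ->
  (\forall x \ae mu, `|u x| <= `|v x|) -> u \in L2.
Proof.
move=> mu_ hv uv; apply: Lfun2P => //.
have iv := integrable_mul hv hv.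
apply/integrableP; split.
  by apply/measurable_EFinP; exact: measurable_funX.
move/integrableP : iv => [mv]; apply: le_lt_trans.
apply: ae_ge0_le_integral => //.
- by do 2 apply: measurableT_comp => //; exact: measurable_funX.
- exact: measurableT_comp.
- apply: filterS uv => x uvx _ /=.
  by rewrite lee_fin normrX normrM -expr2 lerXn2r // nnegrE.
Qed.

Lemma innerC u v : inner u v = inner v u.
Proof. by rewrite /inner; apply: eq_Rintegral => x _; rewrite mulrC. Qed.

Lemma innerDl u v w : u \in L2 -> v \in L2 -> w \in L2 ->
  inner (fun x => u x + v x) w = inner u w + inner v w.
Proof.
move=> hu hv hw; rewrite /inner -RintegralD //; [|exact: integrable_mul..].
by apply: eq_Rintegral => x _; rewrite mulrDl.
Qed.

Lemma innerZl a u v : u \in L2 -> v \in L2 ->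
  inner (fun x => a * u x) v = a * inner u v.
Proof.
move=> hu hv; rewrite /inner -RintegralZl //; last exact: integrable_mul.
by apply: eq_Rintegral => x _; rewrite mulrA.
Qed.

Lemma innerBl u v w : u \in L2 -> v \in L2 -> w \in L2 ->
  inner (fun x => u x - v x) w = inner u w - inner v w.
Proof.
move=> hu hv hw; rewrite /inner -RintegralB //; [|exact: integrable_mul..].
by apply: eq_Rintegral => x _; rewrite mulrBl.
Qed.

Lemma innerDr u v w : u \in L2 -> v \in L2 -> w \in L2 ->
  inner w (fun x => u x + v x) = inner w u + inner w v.
Proof. by move=> *; rewrite innerC innerDl // !(innerC _ w). Qed.

Lemma innerZr a u v : u \in L2 -> v \in L2 ->
  inner v (fun x => a * u x) = a * inner v u.
Proof. by move=> *; rewrite innerC innerZl // innerC. Qed.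

Lemma innerBr u v w : u \in L2 -> v \in L2 -> w \in L2 ->
  inner w (fun x => u x - v x) = inner w u - inner w v.
Proof. by move=> *; rewrite innerC innerBl // !(innerC _ w). Qed.

Lemma inner0l u : inner (fun=> 0) u = 0.
Proof.
rewrite /inner; under eq_Rintegral do rewrite mul0r.
by rewrite /Rintegral integral0.
Qed.

Lemma inner_suml (I : Type) (r : seq I) (F : I -> T -> R) v :
  (forall i, F i \in L2) -> v \in L2 ->
  inner (fun x => \sum_(i <- r) F i x) v = \sum_(i <- r) inner (F i) v.
Proof.
move=> hF hv; elim: r => [|i r IH].
  rewrite big_nil (_ : (fun x => _) = fun=> 0) ?inner0l //.
  by apply/funext => x; rewrite big_nil.
rewrite big_cons -IH -innerDl //; last exact: L2_sum.
by congr inner; apply/funext => x; rewrite big_cons.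
Qed.

Lemma inner_ge0 u : 0 <= inner u u.
Proof. by rewrite Rintegral_ge0 // => x _; rewrite -expr2 sqr_ge0. Qed.

Lemma inner_sqrD u v : u \in L2 -> v \in L2 ->
  inner (fun x => u x + v x) (fun x => u x + v x) =
  inner u u + 2 * inner u v + inner v v.
Proof.
move=> hu hv; rewrite innerDl ?innerDr //; try exact: L2D.
by rewrite (innerC v u); ring.
Qed.

Lemma inner_sqrB u v : u \in L2 -> v \in L2 ->
  inner (fun x => u x - v x) (fun x => u x - v x) =
  inner u u - 2 * inner u v + inner v v.
Proof.
move=> hu hv; rewrite innerBl ?innerBr //; try exact: L2B.
by rewrite (innerC v u); ring.
Qed.

Lemma inner_young u v (t : R) : u \in L2 -> v \in L2 -> 0 < t ->
  2 * inner u v <= t * inner u u + t^-1 * inner v v.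
Proof.
move=> hu hv t0.
have := inner_ge0 (fun x => t * u x - v x).
rewrite inner_sqrB ?L2Z // !innerZl ?L2Z // !innerZr ?L2Z //.
rewrite -(pmulr_rge0 _ (divr_gt0 ltr01 t0)).
have -> : 1 / t * (t * (t * inner u u) - 2 * (t * inner u v) + inner v v) =
    t * inner u u + t^-1 * inner v v - 2 * inner u v.
  by field; rewrite gt_eqF.
by rewrite subr_ge0.
Qed.

Lemma inner_CauchySchwarz u v : u \in L2 -> v \in L2 ->
  inner u v ^+ 2 <= inner u u * inner v v.
Proof.
move=> hu hv.
have H t : 0 <= t ^+ 2 * inner u u - 2 * t * inner u v + inner v v.
  have := inner_ge0 (fun x => t * u x - v x).
  rewrite inner_sqrB ?L2Z // !innerZl ?L2Z // !innerZr ?L2Z //.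
  rewrite (_ : t * (t * inner u u) - 2 * (t * inner u v) + inner v v = t ^+ 2 * inner u u - 2 * t * inner u v + inner v v) //; ring.
have [u0|u0] := eqVneq (inner u u) 0.
  rewrite u0 mul0r.
  suff -> : inner u v = 0 by rewrite expr0n.
  apply/eqP/negPn/negP => uv0.
  (* When [inner u u] vanishes the quadratic is affine in [t]; this [t] makes it equal to -1. *)
  have := H ((inner v v + 1) / (2 * inner u v)).
  rewrite u0 mulr0 add0r.
  have -> : 2 * ((inner v v + 1) / (2 * inner u v)) * inner u v = inner v v + 1.
    by field.
  by lra.
have up : 0 < inner u u by rewrite lt_def u0 inner_ge0.
have := H (inner u v / inner u u).
have -> : (inner u v / inner u u) ^+ 2 * inner u u -
    2 * (inner u v / inner u u) * inner u v + inner v v =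
    (inner u u * inner v v - inner u v ^+ 2) / inner u u by field.
by rewrite pmulr_lge0 ?invr_gt0 // subr_ge0.
Qed.

Lemma inner_subC u v :
  inner (fun x => u x - v x) (fun x => u x - v x) =
  inner (fun x => v x - u x) (fun x => v x - u x).
Proof. by rewrite /inner; apply: eq_Rintegral => x _; ring. Qed.

Lemma ae_eq_L2 u v : measurable_fun [set: T] v -> u \in L2 ->
  (\forall x \ae mu, u x = v x) -> v \in L2.
Proof.
move=> mv hu uv; apply: L2_dominated hu _ => //.
by apply: filterS uv => x ->.
Qed.

Lemma eq_inner_ae u u' v v' : u \in L2 -> u' \in L2 -> v \in L2 -> v' \in L2 ->
  (\forall x \ae mu, u x = u' x) -> (\forall x \ae mu, v x = v' x) ->
  inner u v = inner u' v'.
Proof.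
move=> hu hu' hv hv' uu vv; rewrite /inner /Rintegral; congr fine.
apply: ae_eq_integral => //; try exact: measurable_int (integrable_mul _ _).
by near=> x => _; congr EFin; congr (_ * _); near: x.
Unshelve. all: by end_near. Qed.

Lemma inner_eq0_ae u : u \in L2 -> inner u u = 0 -> \forall x \ae mu, u x = 0.
Proof.
move=> hu u0.
have : ('N[mu]_(2%:E)[EFin \o u])%E = 0%E by rewrite L2norm_inner // u0 sqrtr0.
move/Lnorm_eq0_eq0 => H.
have : ae_eq mu [set: T] (EFin \o u) (cst 0%E).
  by apply: H => //; apply/measurable_EFinP; exact: Lfun_measurable hu.
by apply: filterS => x /(_ I) [].
Qed.

Lemma cvg_inner_l (e : nat -> T -> R) v :
  (forall k, e k \in L2) -> v \in L2 ->
  inner (e k) (e k) @[k --> \oo] --> 0 -> inner (e k) v @[k --> \oo] --> 0.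
Proof.
move=> he hv e0.
have s0 : Num.sqrt (inner (e k) (e k) * inner v v) @[k --> \oo] --> 0.
  rewrite -[X in _ --> X]sqrtr0; apply: continuous_cvg.
    exact: sqrt_continuous.
  by rewrite -[X in _ --> X](mul0r (inner v v)); exact: cvgMl.
apply/norm_cvg0P; apply: (@squeeze_cvgr _ _ _ _ (fun=> 0) _ _ _ 0 _ s0).
  apply: nearW => k; rewrite normr_ge0 /= -sqrtr_sqr ler_sqrt.
    exact: inner_CauchySchwarz.
  by rewrite mulr_ge0 // inner_ge0.
exact: cvg_cst.
Qed.

(* h is the sum of the series 4^k e_k^2, whose integral is at most 2 *)
Lemma fast_domination (e : nat -> T -> R) :
  (forall k, e k \in L2) -> (forall k, inner (e k) (e k) <= 8^-1 ^+ k) ->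
  exists h : T -> R, [/\ mu.-integrable [set: T] (EFin \o h),
    forall x, 0 <= h x &
    \forall x \ae mu, forall k, e k x ^+ 2 <= h x * 4^-1 ^+ k].
Proof.
move=> he e8.
pose g k x := (4 ^+ k * e k x ^+ 2)%:E.
have g0 k x : (0 <= g k x)%E by rewrite lee_fin mulr_ge0 ?sqr_ge0 ?exprn_ge0.
have mg k : measurable_fun [set: T] (g k).
  apply/measurable_EFinP; apply: measurable_funM => //; apply: measurable_funX.
  exact: Lfun_measurable (he k).
pose H x := (\sum_(k <oo) g k x)%E.
have H0 x : (0 <= H x)%E by apply: nneseries_ge0.
have mH : measurable_fun [set: T] H by apply: ge0_emeasurable_sum.
have iH : mu.-integrable [set: T] H.
  apply/integrableP; split => //.
  under eq_integral do rewrite gee0_abs //.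
  rewrite integral_nneseries //.
  (* The [k]-th integral is at most [4^k * 8^-k = 2^-k]. *)
  apply: (@le_lt_trans _ _ (\sum_(k <oo) (2^-1 ^+ k)%:E)%E); last first.
    have /= := @cvg_geometric_eseries_half R 2 0.
    have -> : eseries (fun k => (2 / (2 ^ (k + 1))%:R)%:E) =
              eseries (fun k => (2^-1 ^+ k : R)%:E).
      apply/funext => n; rewrite /eseries /=; apply: eq_bigr => k _.
      by rewrite addn1 expnS natrM natrX exprVn invfM mulrA mulfV ?mul1r.
    by move/cvg_lim => -> //; rewrite ltry.
  apply: lee_nneseries => [k _ _|k _]; first exact: integral_ge0.
  rewrite (_ : \int[mu]_x g k x = (4 ^+ k * inner (e k) (e k))%:E)%E.
    rewrite lee_fin (le_trans (ler_wpM2l _ (e8 k))) ?exprn_ge0 // -exprMn.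
    by rewrite (_ : 4 * 8^-1 = 2^-1 :> R) //; field.
  rewrite -innerZr // -EFin_inner ?L2Z //.
  by apply: eq_integral => x _; congr EFin; ring.
exists (fine \o H); split.
- apply: le_integrable iH => //.
    apply/measurable_EFinP; apply: measurableT_comp => //.
  by move=> x _ /=; case: (H x) => [r||] /=; rewrite ?lexx ?leey.
- by move=> x; exact: fine_ge0.
- have := integrable_ae measurableT iH; apply: filterS => x /(_ I) fH k.
  have := @nneseries_lim_ge R (g ^~ x) xpredT 0 k.+1 (fun n _ _ => g0 n x).
  rewrite -/(H x) -[H x]fineK // big_nat_recr //= => gH.
  have : (g k x <= (fine (H x))%:E)%E.
    by apply: le_trans gH; rewrite leeDr // sume_ge0.
  rewrite lee_fin exprVn => gk.
  by rewrite -ler_pdivrMr ?invr_gt0 ?exprn_gt0 // invrK mulrC.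
Qed.

Lemma fast_cvg0 (e : nat -> T -> R) :
  (forall k, e k \in L2) -> (forall k, inner (e k) (e k) <= 8^-1 ^+ k) ->
  \forall x \ae mu, e k x @[k --> \oo] --> 0.
Proof.
move=> he e8; have [h [ih h0 eh]] := fast_domination he e8.
apply: filterS eh => x ex.
have s0 : (Num.sqrt (h x) * 2^-1 ^+ k) @[k --> \oo] --> 0.
  rewrite -(mulr0 (Num.sqrt (h x))).
  by apply: cvgMr; apply: cvg_expr; rewrite ger0_norm // invf_lt1 // ltr1n.
apply/norm_cvg0P; apply: (@squeeze_cvgr _ _ _ _ (fun=> 0) _ _ _ 0 _ s0).
  apply: nearW => k; rewrite normr_ge0 /= -(@ler_pXn2r _ 2) ?nnegrE ?mulr_ge0 ?exprn_ge0 //.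
  rewrite real_normK ?num_real // exprMn sqr_sqrtr // -exprM mulnC exprM.
  by rewrite (_ : 2^-1 ^+ 2 = 4^-1 :> R) //; field.
exact: cvg_cst.
Qed.

(** Off a null set the increments are at most [sqrt (h x) * 2^-k]. So the sequence converges
    pointwise, and the squared error is at most the integrable function [4 * h * 4^-k]. *)
Lemma fast_cauchy_cvg (u : nat -> T -> R) :
  (forall k, u k \in L2) ->
  (forall k, inner (fun x => u k.+1 x - u k x) (fun x => u k.+1 x - u k x)
             <= 8^-1 ^+ k) ->
  exists2 v, v \in L2 &
    inner (fun x => u k x - v x) (fun x => u k x - v x) @[k --> \oo] --> 0.
Proof.
move=> hu u8.
have [h [ih h0 [N [mN N0 sN]]]] :=
  fast_domination (fun k => L2B (hu k.+1) (hu k)) u8.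
have mCN : measurable (~` N) by exact: measurableC.
have muk k : measurable_fun [set: T] (u k) by exact: Lfun_measurable (hu k).
have mh : measurable_fun [set: T] h by apply/measurable_EFinP; exact: measurable_int ih.
pose u' k := u k \_ (~` N).
have step x : cvgn (u' ^~ x) /\
    forall k, `|limn (u' ^~ x) - u' k x| <= 2 * Num.sqrt (h x) * 2^-1 ^+ k.
  apply: cvg_of_geometric_steps => k.
  rewrite -(@ler_pXn2r _ 2) ?nnegrE ?mulr_ge0 ?exprn_ge0 //.
  rewrite real_normK ?num_real // exprMn sqr_sqrtr // -exprM mulnC exprM.
  rewrite (_ : 2^-1 ^+ 2 = 4^-1 :> R); last by field.
  rewrite /u' !patchE; case: ifPn => xN.
    apply: contrapT => nx; move: xN; rewrite inE /=; apply.
    by apply: sN => /= /(_ k).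
  by rewrite subrr expr0n /= mulr_ge0 // exprn_ge0.
pose v x := limn (u' ^~ x).
have mv : measurable_fun [set: T] v.
  apply: (@measurable_fun_cvg _ _ _ _ u') => [k|x _]; last exact: (step x).1.
  apply: (measurable_restrictT _ mCN).1; exact: measurable_funTS (muk k).
have uv k x : ~ N x -> (u k x - v x) ^+ 2 <= 4 * h x * 4^-1 ^+ k.
  move=> Nx; have := (step x).2 k.
  rewrite /u' patchE mem_set // -/(v x) distrC => H.
  rewrite -real_normK ?num_real //; apply: le_trans (_ : (2 * Num.sqrt (h x) * 2^-1 ^+ k) ^+ 2 <= _).
    by rewrite lerXn2r // nnegrE ?mulr_ge0 ?exprn_ge0.
  rewrite !exprMn sqr_sqrtr // -exprM mulnC exprM.
  rewrite (_ : 2^-1 ^+ 2 = 4^-1 :> R); last by field.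
  by rewrite (_ : 2 ^+ 2 = 4 :> R) //; ring.
have aeN : \forall x \ae mu, ~ N x by exists N; split => // x /= /contrapT.
have iuv k : mu.-integrable [set: T] (EFin \o (fun x => (u k x - v x) ^+ 2)).
  have ih4 : mu.-integrable [set: T] (fun x => (4 * 4^-1 ^+ k)%:E * (EFin \o h) x)%E.
    exact: integrableZl.
  apply/integrableP; split.
    by apply/measurable_EFinP/measurable_funX/measurable_funB.
  move/integrableP : ih4 => [mh4]; apply: le_lt_trans.
  apply: ae_ge0_le_integral => //.
  - by do 2 apply: measurableT_comp => //; apply/measurable_funX/measurable_funB.
  - exact: measurableT_comp.
  - apply: filterS aeN => x Nx _; rewrite /= lee_fin !ger0_norm ?sqr_ge0 //; last first.
      by rewrite !mulr_ge0 ?exprn_ge0.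
    by apply: le_trans (uv k x Nx) _; rewrite mulrAC.
have huv k : (fun x => u k x - v x) \in L2.
  by apply: Lfun2P => //; exact: measurable_funB.
exists v.
  have -> : v = (fun x => u 0%N x - (u 0%N x - v x)).
    by apply/funext => x; rewrite subKr.
  exact: L2B.
pose c := 4 * \int[mu]_x h x.
have s0 : (c * 4^-1 ^+ k) @[k --> \oo] --> 0.
  rewrite -(mulr0 c).
  by apply: cvgMr; apply: cvg_expr; rewrite ger0_norm // invf_lt1 // ltr1n.
apply: (@squeeze_cvgr _ _ _ _ (fun=> 0) _ _ _ 0 _ s0); last exact: cvg_cst.
apply: nearW => k; rewrite inner_ge0 /= /c.
rewrite mulrAC -RintegralZl // -lee_fin -EFin_inner // /Rintegral fineK; last first.
  apply: integrable_fin_num => //.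
  exact: (@integrableZl _ _ _ mu _ measurableT (4 * 4^-1 ^+ k) (EFin \o h)).
apply: ae_ge0_le_integral => //.
- by move=> x _; rewrite lee_fin -expr2 sqr_ge0.
- exact: measurable_int (integrable_mul (huv k) (huv k)).
- by move=> x _; rewrite lee_fin !mulr_ge0 ?exprn_ge0.
- by apply/measurable_EFinP; exact: measurable_funM.
apply: filterS aeN => x Nx _; rewrite /= lee_fin -expr2.
by apply: le_trans (uv k x Nx) _; rewrite mulrAC.
Qed.

End square_integrable.

(** * Nested closed convex sets of square integrable functions *)

Section nested_convex.
Context d (T : measurableType d) (R : realType).
Variable mu : {measure set T -> \bar R}.
Local Notation L2 := (Lfun mu 2%:E).
Local Notation inner := (inner mu).
Variables (C : nat -> set (T -> R)) (M : R).
Hypothesis CL2 : forall m u, C m u -> u \in L2.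
Hypothesis C0 : forall m, C m !=set0.
Hypothesis Cle : forall m l, (m <= l)%N -> C l `<=` C m.
Hypothesis CM : forall u, C 0%N u -> inner u u <= M.
Hypothesis Cmid : forall m u v, C m u -> C m v ->
  C m (fun x => 2^-1 * (u x + v x)).
Hypothesis Cclosed : forall m (v : nat -> T -> R) u,
  (forall k, C m (v k)) -> u \in L2 ->
  inner (fun x => v k x - u x) (fun x => v k x - u x) @[k --> \oo] --> 0 ->
  C m u.

Let r m := inf [set inner u u | u in C m].

Let has_infC m : has_inf [set inner u u | u in C m].
Proof.
split; first by have [u Cu] := C0 m; exists (inner u u); exists u.
by exists 0 => _ [u _ <-]; exact: inner_ge0.
Qed.

Let r_le m u : C m u -> r m <= inner u u.
Proof. by move=> Cu; apply: ge_inf; [exact: (has_infC m).2|exists u]. Qed.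

Let r_nd m l : (m <= l)%N -> r m <= r l.
Proof.
move=> ml; apply: lb_le_inf; first exact: (has_infC l).1.
by move=> _ [u Cu <-]; apply: r_le; exact: Cle ml _ Cu.
Qed.

Let has_supr : has_sup (range r).
Proof.
split; first by exists (r 0%N); exists 0%N.
exists M => _ [m _ <-]; have [u Cu] := C0 m.
apply: le_trans (r_le Cu) _; apply: CM; exact: Cle (leq0n m) _ Cu.
Qed.

Let D := sup (range r).

Let r_leD m : r m <= D.
Proof. by apply: ub_le_sup; [exact: has_supr.2|exists m]. Qed.

(* By the parallelogram identity the elements of almost minimal norm of the *)
(* sets [C m] form a Cauchy sequence.                                       *)
Lemma nested_convex_inter : exists u, forall m, C m u.
Proof.
(* The parallelogram identity bounds the squared steps by [2 * e k.+1 + 6 * e k <= 8 * e k], which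
   is the rate that [fast_cauchy_cvg] asks for. *)
pose e k : R := 8^-1 ^+ k / 8.
have e0 k : 0 < e k by rewrite divr_gt0 ?exprn_gt0.
have eS k : e k.+1 <= e k by rewrite /e exprS ler_pM2r ?invr_gt0 // ler_piMl ?exprn_ge0 // invf_le1 // ler1n.
pose P k (p : nat * (T -> R)) :=
  [/\ (k <= p.1)%N, D - e k <= r p.1, C p.1 p.2 & inner p.2 p.2 <= D + e k].
have /choice[s sP] k : exists p, P k p.
  have [_ [n _ <-] nD] := sup_adherent (e0 k) has_supr.
  (* An index at least [k] brings the sequence eventually into every [C m]; an index at least [n]
     keeps the infimum within [e k] of [D], since the infima increase. *)
  have [_ [v Cv <-] vr] := inf_adherent (e0 k) (has_infC (maxn k n)).
  exists (maxn k n, v); split => //=; first exact: leq_maxl.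
    by apply: le_trans (ltW nD) _; apply: r_nd; exact: leq_maxr.
  by apply: le_trans (ltW vr) _; rewrite lerD2r; exact: r_leD.
have hs k : (s k).2 \in L2 by have [_ _ + _] := sP k; exact: CL2.
have step k : inner (fun x => (s k.+1).2 x - (s k).2 x)
                    (fun x => (s k.+1).2 x - (s k).2 x) <= 8^-1 ^+ k.
  have [k1 r1 C1 n1] := sP k; have [k2 r2 C2 n2] := sP k.+1.
  pose p := minn (s k).1 (s k.+1).1.
  have rp : D - e k <= r p.
    rewrite /p; case: leqP => _ //.
    by apply: le_trans r2; have := eS k; lra.
  have Cp1 : C p (s k).2 by apply: Cle C1; exact: geq_minl.
  have Cp2 : C p (s k.+1).2 by apply: Cle C2; exact: geq_minr.
  have := le_trans rp (r_le (Cmid Cp1 Cp2)).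
  rewrite innerZl ?innerZr ?L2Z ?L2D // inner_sqrD // inner_sqrB //.
  rewrite (innerC mu (s k.+1).2).
  have -> : (8^-1 : R) ^+ k = 8 * e k by rewrite /e mulrC mulfVK.
  by have := eS k; lra.
have [u hu su] := fast_cauchy_cvg hs step.
exists u => m; apply: (@Cclosed m (fun k => (s (k + m)%N).2)) => //.
- move=> k; have [k1 _ C1 _] := sP (k + m)%N.
  by apply: Cle C1; apply: leq_trans k1; exact: leq_addl.
- by have := su; rewrite -(cvg_shiftn m).
Qed.

End nested_convex.

(** Indices at which the squared distance is below [8^-k] bring the sequence under [fast_cvg0]. The
    bound [k <= s k] suffices to transfer limits to the selected terms. *)
Lemma cvg_subsequence_ae d (T : measurableType d) (R : realType)
    (mu : {measure set T -> \bar R}) (v : nat -> T -> R) (u : T -> R) :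
  (forall k, v k \in Lfun mu 2%:E) -> u \in Lfun mu 2%:E ->
  inner mu (fun x => v k x - u x) (fun x => v k x - u x) @[k --> \oo] --> 0 ->
  exists2 s : nat -> nat, (forall k, (k <= s k)%N) &
    \forall x \ae mu, v (s k) x @[k --> \oo] --> u x.
Proof.
move=> hv hu vu.
have /choice[s sP] k : exists n, (k <= n)%N /\
    inner mu (fun x => v n x - u x) (fun x => v n x - u x) <= 8^-1 ^+ k.
  have e0 : 0 < (8^-1 : R) ^+ k by rewrite exprn_gt0.
  have /cvgrPdist_lt/(_ _ e0)[N _ NP] := vu.
  exists (maxn k N); split; first exact: leq_maxl.
  have := NP (maxn k N) (leq_maxr _ _).
  by rewrite sub0r normrN ger0_norm ?inner_ge0 // => /ltW.
exists s => [k|]; first exact: (sP k).1.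
have hvu k : (fun x => v (s k) x - u x) \in Lfun mu 2%:E by exact: L2B.
apply: filterS (fast_cvg0 hvu (fun k => (sP k).2)) => x.
by move=> /cvg_sub0; apply; exact: cvg_cst.
Qed.

(** * Orthonormal bases and multipliers *)

Section inner_limits.
Context d (T : measurableType d) (R : realType).
Variable mu : {measure set T -> \bar R}.
Local Notation L2 := (Lfun mu 2%:E).
Local Notation inner := (inner mu).
Implicit Types u v w : T -> R.

Lemma inner_le_sqrt u v : u \in L2 -> v \in L2 ->
  `|inner u v| <= Num.sqrt (inner u u) * Num.sqrt (inner v v).
Proof.
move=> hu hv; rewrite -sqrtr_sqr -sqrtrM ?inner_ge0 // ler_sqrt.
  exact: inner_CauchySchwarz.
by rewrite mulr_ge0 // inner_ge0.
Qed.

Lemma cvg_inner (v : nat -> T -> R) u w :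
  (forall k, v k \in L2) -> u \in L2 -> w \in L2 ->
  inner (fun x => v k x - u x) (fun x => v k x - u x) @[k --> \oo] --> 0 ->
  inner (v k) w @[k --> \oo] --> inner u w.
Proof.
move=> hv hu hw vu.
have := cvg_inner_l (fun k => L2B (hv k) hu) hw vu.
under eq_fun do rewrite innerBl //.
by move=> /cvg_sub0; apply; exact: cvg_cst.
Qed.

(** Nonnegativity of [|v k - u|^2] gives [2 <v k, u> <= M + |u|^2], and the left-hand side tends to
    [2 |u|^2]. *)
Lemma inner_lim_le (v : nat -> T -> R) u M :
  (forall k, v k \in L2) -> u \in L2 ->
  inner (fun x => v k x - u x) (fun x => v k x - u x) @[k --> \oo] --> 0 ->
  (forall k, inner (v k) (v k) <= M) -> inner u u <= M.
Proof.
move=> hv hu vu vM; have l := cvg_inner hv hu hu vu.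
have : inner u u <= (M + inner u u) / 2.
  rewrite -[leLHS](cvg_lim _ l) //; apply: limr_le; first by apply/cvg_ex; eexists; exact: l.
  apply: nearW => k; have := inner_ge0 mu (fun x => v k x - u x).
  by rewrite inner_sqrB //; have := vM k; lra.
by lra.
Qed.

Lemma inner_mid u v : u \in L2 -> v \in L2 ->
  inner (fun x => 2^-1 * (u x + v x)) (fun x => 2^-1 * (u x + v x)) <=
  2^-1 * (inner u u + inner v v).
Proof.
move=> hu hv; have hD := L2D hu hv.
rewrite innerZl ?L2Z // innerZr // inner_sqrD //.
by have := inner_ge0 mu (fun x => u x - v x); rewrite inner_sqrB //; lra.
Qed.

Lemma eq_inner_ael u u' v : u \in L2 -> u' \in L2 -> v \in L2 ->
  (\forall x \ae mu, u x = u' x) -> inner u v = inner u' v.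
Proof. by move=> hu hu' hv uu; apply: eq_inner_ae => //; exact: nearW. Qed.

Lemma inner_sub_le u v : u \in L2 -> v \in L2 ->
  inner (fun x => u x - v x) (fun x => u x - v x) <=
  2 * inner u u + 2 * inner v v.
Proof.
move=> hu hv; have := inner_ge0 mu (fun x => u x + v x).
by rewrite inner_sqrD // inner_sqrB //; lra.
Qed.

End inner_limits.

Section orthonormal_basis.
Context d (T : measurableType d) (R : realType).
Variable mu : {measure set T -> \bar R}.
Local Notation L2 := (Lfun mu 2%:E).
Local Notation inner := (inner mu).
Implicit Types u v w : T -> R.

Definition partial_sum (phi : nat -> T -> R) (c : nat -> R) (m : nat) : T -> R :=
  fun x => \sum_(k < m) c k * phi k x.

Definition hilbert_basis (phi : nat -> T -> R) :=
  [/\ forall k, phi k \in L2,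
    forall j k, inner (phi j) (phi k) = (j == k)%:R &
    forall u, u \in L2 ->
      let e m x := u x - partial_sum phi (fun k => inner u (phi k)) m x in
      inner (e m) (e m) @[m --> \oo] --> 0].

Variable phi : nat -> T -> R.
Hypothesis basis : hilbert_basis phi.

Let hphi k : phi k \in L2. Proof. by case: basis. Qed.
Let ortho j k : inner (phi j) (phi k) = (j == k)%:R. Proof. by case: basis. Qed.
Local Notation coef u := (fun k => inner u (phi k)).
Local Notation psum := (partial_sum phi).

Lemma psum_L2 c m : psum c m \in L2.
Proof. by apply: L2_sum => k; exact: L2Z. Qed.

Lemma inner_psuml u c m : u \in L2 ->
  inner (psum c m) u = \sum_(k < m) c k * inner u (phi k).
Proof.
move=> hu; rewrite /partial_sum inner_suml // => [|k]; last exact: L2Z.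
by apply: eq_bigr => k _; rewrite innerZl // innerC.
Qed.

Lemma coef_psum c m j : inner (psum c m) (phi j) = if (j < m)%N then c j else 0.
Proof.
rewrite inner_psuml //; case: ltnP => jm.
  rewrite (bigD1 (Ordinal jm)) //= ortho eqxx mulr1 big1 ?addr0 // => i ij.
  rewrite ortho (_ : (j == i) = false) ?mulr0 //.
  by apply/negbTE; apply: contra ij => /eqP ij; apply/eqP/val_inj.
rewrite big1 // => i _; rewrite ortho (_ : (j == i) = false) ?mulr0 //.
by apply/negbTE; rewrite neq_ltn (leq_trans (ltn_ord i) jm) orbT.
Qed.

Lemma psum_sqr c m : inner (psum c m) (psum c m) = \sum_(k < m) c k ^+ 2.
Proof.
rewrite inner_psuml ?psum_L2 //; apply: eq_bigr => k _.
by rewrite coef_psum ltn_ord expr2.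
Qed.

Lemma inner_sub_psum u m : u \in L2 ->
  inner (fun x => u x - psum (coef u) m x) (fun x => u x - psum (coef u) m x) =
  inner u u - \sum_(k < m) inner u (phi k) ^+ 2.
Proof.
move=> hu; rewrite inner_sqrB ?psum_L2 // psum_sqr (innerC _ u (psum _ _)).
rewrite inner_psuml // (eq_bigr (fun k : 'I_m => inner u (phi k) ^+ 2)).
  by ring.
by move=> k _; rewrite expr2.
Qed.

Lemma bessel u m : u \in L2 -> \sum_(k < m) inner u (phi k) ^+ 2 <= inner u u.
Proof.
by move=> hu; rewrite -subr_ge0 -inner_sub_psum // inner_ge0.
Qed.

Lemma parseval_le u M : u \in L2 ->
  (forall m, \sum_(k < m) inner u (phi k) ^+ 2 <= M) -> inner u u <= M.
Proof.
move=> hu uM; have [_ _ /(_ u hu)/= l] := basis.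
rewrite -subr_le0 -[leRHS](cvg_lim _ l) //.
apply: limr_ge; first by apply/cvg_ex; eexists; exact: l.
by apply: nearW => m; rewrite inner_sub_psum // lerB.
Qed.

Lemma coef_ae_eq u v : u \in L2 -> v \in L2 ->
  (forall k, inner u (phi k) = inner v (phi k)) -> \forall x \ae mu, u x = v x.
Proof.
move=> hu hv uv; have huv := L2B hu hv.
have : inner (fun x => u x - v x) (fun x => u x - v x) = 0.
  apply/eqP; rewrite eq_le inner_ge0 andbT; apply: parseval_le => // m.
  by rewrite big1 // => k _; rewrite innerBl // uv subrr expr0n.
move/(inner_eq0_ae huv); apply: filterS => x /eqP.
by rewrite subr_eq0 => /eqP.
Qed.

(** The functions of squared norm at most [M] with first [m] coefficients prescribed form nested
    closed convex sets, nonempty because of the partial sums. *)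
Lemma riesz_fischer (c : nat -> R) M : (forall m, \sum_(k < m) c k ^+ 2 <= M) ->
  exists2 w, w \in L2 & forall k, inner w (phi k) = c k.
Proof.
move=> cM.
pose C m : set (T -> R) := [set w | [/\ w \in L2, inner w w <= M &
  forall k, (k < m)%N -> inner w (phi k) = c k]].
have [] := @nested_convex_inter _ _ _ mu C M.
- by move=> m u [].
- move=> m; exists (psum c m); split; rewrite ?psum_L2 ?psum_sqr // => k km.
  by rewrite coef_psum km.
- by move=> m l ml u [hu uM uc]; split => // k km; apply: uc; exact: leq_trans ml.
- by move=> u [].
- move=> m u v [hu uM uc] [hv vM vc]; split.
  + by rewrite L2Z // L2D.
  + by apply: le_trans (inner_mid hu hv) _; lra.
  + by move=> k km; rewrite innerZl ?L2D // innerDl // uc // vc //; field.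
- move=> m v u vC hu vu; have hv k : v k \in L2 by case: (vC k).
  split => //; first by apply: inner_lim_le vu _ => // k; case: (vC k).
  move=> k km; have l := cvg_inner hv hu (hphi k) vu.
  rewrite -(cvg_lim _ l) // (_ : (fun j => _) = fun=> c k).
    exact: lim_cst.
  by apply/funext => j; case: (vC j) => _ _; apply.
move=> w wC; exists w; first by case: (wC 0%N).
by move=> k; case: (wC k.+1) => _ _; apply.
Qed.

Lemma coef_of_expansion w c : w \in L2 ->
  inner (fun x => w x - psum c m x) (fun x => w x - psum c m x) @[m --> \oo] --> 0 ->
  forall k, inner w (phi k) = c k.
Proof.
move=> hw wc k.
have l := cvg_inner (psum_L2 c) hw (hphi k) _.
rewrite -(cvg_lim _ (l _)) //; last by under eq_fun do rewrite inner_subC.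
apply: lim_near_cst => //; exists k.+1 => // m /= km.
by rewrite coef_psum km.
Qed.

(** * Unbounded operators that are diagonal in the basis *)

Section weights.
Variable wt : nat -> R.
Hypothesis wt_gt0 : forall k, 0 < wt k.
Hypothesis wt_nd : {homo wt : j k / (j <= k)%N >-> j <= k}.

(* [multiplier u w] says that [w] is the image of [u] under the unbounded    *)
(* operator with eigenvalues [wt] and eigenfunctions [phi].                  *)
Definition multiplier u w := [/\ u \in L2, w \in L2 &
  forall k, inner w (phi k) = wt k * inner u (phi k)].

Lemma multiplierD u w u' w' : multiplier u w -> multiplier u' w' ->
  multiplier (fun x => u x + u' x) (fun x => w x + w' x).
Proof.
move=> [hu hw uw] [hu' hw' uw']; split; rewrite ?L2D // => k.
by rewrite !innerDl // uw uw' mulrDr.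
Qed.

Lemma multiplierZ a u w : multiplier u w ->
  multiplier (fun x => a * u x) (fun x => a * w x).
Proof.
move=> [hu hw uw]; split; rewrite ?L2Z // => k.
by rewrite !innerZl // uw mulrCA.
Qed.

Lemma multiplierB u w u' w' : multiplier u w -> multiplier u' w' ->
  multiplier (fun x => u x - u' x) (fun x => w x - w' x).
Proof.
move=> [hu hw uw] [hu' hw' uw']; split; rewrite ?L2B // => k.
by rewrite !innerBl // uw uw' mulrBr.
Qed.

Lemma multiplier_coef u w k : multiplier u w ->
  inner u (phi k) = inner w (phi k) / wt k.
Proof. by move=> [_ _ ->]; rewrite mulrAC mulfV ?gt_eqF // mul1r. Qed.

(** From index [N] on, the coefficients of [w] are at least [wt N] times those of [u] in absolute
    value. Once [wt] is unbounded, this is the source of compactness. *)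
Lemma multiplier_tail u w N : multiplier u w ->
  wt N ^+ 2 * inner (fun x => u x - psum (coef u) N x)
                    (fun x => u x - psum (coef u) N x) <= inner w w.
Proof.
move=> uw; have [hu hw cuw] := uw.
pose u' x := u x - psum (coef u) N x; rewrite -/u'.
have hu' : u' \in L2 by rewrite L2B // psum_L2.
rewrite mulrC -ler_pdivlMr ?exprn_gt0 //; apply: parseval_le => // m.
rewrite ler_pdivlMr ?exprn_gt0 // mulr_suml; apply: le_trans (bessel m hw).
apply: ler_sum => k _; rewrite innerBl ?psum_L2 // coef_psum cuw.
case: ltnP => kN; first by rewrite subrr expr0n mul0r sqr_ge0.
rewrite subr0 exprMn mulrC ler_wpM2r ?sqr_ge0 //.
by apply: lerXn2r; rewrite ?nnegrE ?wt_nd // ltW.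
Qed.

Lemma multiplier_poincare u w : multiplier u w ->
  wt 0 ^+ 2 * inner u u <= inner w w.
Proof.
move=> /(multiplier_tail 0).
have -> : (fun x => u x - psum (coef u) 0 x) = u.
  by apply/funext => x; rewrite /partial_sum big_ord0 subr0.
by [].
Qed.

Lemma multiplier_surj w : w \in L2 -> exists u, multiplier u w.
Proof.
move=> hw.
have [|u hu uc] := @riesz_fischer (fun k => inner w (phi k) / wt k)
    (inner w w / wt 0 ^+ 2).
  move=> m; rewrite ler_pdivlMr ?exprn_gt0 // mulr_suml.
  apply: le_trans (bessel m hw); apply: ler_sum => k _.
  rewrite expr_div_n -mulrA ler_piMr ?sqr_ge0 //.
  rewrite mulrC ler_pdivrMr ?exprn_gt0 // mul1r.
  by apply: lerXn2r; rewrite ?nnegrE ?wt_nd // ltW.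
by exists u; split => // k; rewrite uc mulrC divfK // gt_eqF.
Qed.

Lemma multiplier_unique u w u' w' : multiplier u w -> multiplier u' w' ->
  (\forall x \ae mu, w x = w' x) -> \forall x \ae mu, u x = u' x.
Proof.
move=> uw uw' ww.
have [hu hw _] := uw; have [hu' hw' _] := uw'.
apply: coef_ae_eq => // k; rewrite (multiplier_coef k uw) (multiplier_coef k uw'); congr (_ / _).
apply: eq_inner_ae => //.
exact: nearW.
Qed.

(** A bound on the dual norm of [z]: pairing with the tail of [u] costs [1 / wt N], and each of the
    first [N] coefficients of [u] is at most [|w| / wt 0]. *)
Lemma multiplier_dual u w z N : multiplier u w -> z \in L2 ->
  inner z u <= (Num.sqrt (inner z z) / wt N +
    (\sum_(k < N) `|inner z (phi k)|) / wt 0) * Num.sqrt (inner w w).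
Proof.
move=> uw hz; have [hu hw _] := uw.
have sw0 := sqrtr_ge0 (inner w w); have sz0 := sqrtr_ge0 (inner z z).
rewrite mulrDl.
pose u' x := u x - psum (coef u) N x.
have hu' : u' \in L2 by rewrite L2B // psum_L2.
have -> : inner z u = inner z u' + inner z (psum (coef u) N).
  rewrite -innerDr ?psum_L2 //; congr (inner _ _).
  by apply/funext => x; rewrite /u' subrK.
apply: lerD.
  apply: le_trans (ler_norm _) _; apply: le_trans (inner_le_sqrt hz hu') _.
  rewrite -mulrA ler_wpM2l // mulrC ler_pdivlMr // -[X in _ * X]gtr0_norm //.
  rewrite -sqrtr_sqr -sqrtrM ?inner_ge0 // ler_sqrt ?inner_ge0 // mulrC.
  exact: (multiplier_tail N uw).
rewrite innerC inner_psuml // -mulrA mulr_suml; apply: ler_sum => k _.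
apply: le_trans (ler_norm _) _; rewrite normrM mulrC ler_wpM2l //.
rewrite (multiplier_coef k uw) normrM.
have wk : `|inner w (phi k)| <= Num.sqrt (inner w w).
  apply: le_trans (inner_le_sqrt hw (hphi k)) _.
  by rewrite ortho eqxx sqrtr1 mulr1.
rewrite mulrC gtr0_norm ?invr_gt0 //; apply: ler_pM => //.
  by rewrite invr_ge0 ltW.
by rewrite lef_pV2 ?posrE // wt_nd.
Qed.

End weights.
End orthonormal_basis.

(** * The nonlinearity and its primitive *)

Section primitive_subgradient.
Context {R : realType}.
Variable f : R -> R.
Hypothesis f_cont : continuous f.
Hypothesis f_nd : {homo f : r t / r <= t}.
Hypothesis f_odd : forall t, f (- t) = - f t.

Let F (t : R) := \int[lebesgue_measure]_(tau in `[0, `|t|]) f tau.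

Let f_int (a b : R) : lebesgue_measure.-integrable `[a, b] (EFin \o f).
Proof.
apply: continuous_compact_integrable; first exact: segment_compact.
exact: continuous_subspaceT.
Qed.

Let f_int' (a b : R) : lebesgue_measure.-integrable `]a, b] (EFin \o f).
Proof. by apply: integrableS (f_int a b) => //; apply: subset_itvr; rewrite bnd_simp. Qed.

Let F_bounds (a b : R) : 0 <= a -> a <= b ->
  (b - a) * f a <= F b - F a <= (b - a) * f b.
Proof.
move=> a0 ab; have b0 := le_trans a0 ab.
rewrite /F !ger0_norm // Rintegral_itvB //.
have cst_int (c : R) : \int[lebesgue_measure]_(x in `]a, b]) c = (b - a) * c.
  rewrite (Rintegral_cst lebesgue_measure (D := `]a, b])) // mulrC; congr (_ * _).
  rewrite [X in fine X](lebesgue_measure_itv `]a, b]) /= lte_fin; case: ltP => //= ba.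
  by apply/esym/eqP; rewrite subr_eq0 eq_le ba ab.
have cst_integrable (c : R) : lebesgue_measure.-integrable `]a, b] (EFin \o (fun=> c)).
  have h : lebesgue_measure.-integrable `[a, b] (EFin \o (fun=> c)).
    apply: continuous_compact_integrable; first exact: segment_compact.
    by apply: continuous_subspaceT => x; exact: cvg_cst.
  by apply: integrableS h => //; apply: subset_itvr; rewrite bnd_simp.
rewrite -!cst_int; apply/andP; split; apply: le_Rintegral => // x.
  by rewrite /= in_itv /= => /andP[/ltW /f_nd].
by rewrite /= in_itv /= => /andP[_ /f_nd].
Qed.

Let f_ge0 a : 0 <= a -> 0 <= f a.
Proof.
move=> /f_nd; have := f_odd 0; rewrite oppr0 => f0.
by have -> : f 0 = 0 by lra.
Qed.

(** For nonnegative arguments the integral over an interval lies between its length times the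
    endpoint values of [f]; evenness of [F] and oddness of [f] give the other signs. *)
Lemma primitive_subgradient a b : f a * (b - a) <= F b - F a.
Proof.
have pos x y : 0 <= x -> 0 <= y -> f x * (y - x) <= F y - F x.
  move=> x0 y0; have [xy|/ltW yx] := leP x y.
    by have /andP[+ _] := F_bounds x0 xy; rewrite mulrC.
  by have /andP[_] := F_bounds y0 yx; lra.
have posl x y : 0 <= x -> f x * (y - x) <= F y - F x.
  move=> x0; have -> : F y = F `|y| by rewrite /F normr_id.
  apply: le_trans (pos x `|y| x0 (normr_ge0 _)).
  by rewrite ler_wpM2l ?f_ge0 // lerD2r ler_norm.
have [a0|/ltW a0] := leP 0 a; first exact: posl.
have := posl (- a) (- b).
rewrite oppr_ge0 => /(_ a0); rewrite f_odd /F !normrN.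
by apply: le_trans; lra.
Qed.

End primitive_subgradient.

Section superposition.
Context d (T : measurableType d) (R : realType).
Import HBSimple.

(** For simple [u] a preimage is a finite union over the values of [u]; continuity of [f x] passes
    to pointwise limits of simple functions. *)
Lemma measurable_superposition (f : T -> R -> R) (u : T -> R) :
  (forall x, continuous (f x)) ->
  (forall t, measurable_fun [set: T] (f ^~ t)) ->
  measurable_fun [set: T] u -> measurable_fun [set: T] (fun x => f x (u x)).
Proof.
move=> fc fm um; have [|g gu] := @approximation_sfun _ T R (EFin \o u) setT measurableT.
  exact/measurable_EFinP.
apply: (@measurable_fun_cvg _ _ _ _ (fun m x => f x (g m x))).
  move=> m _ B mB; rewrite setTI.
  rewrite (_ : _ @^-1` B = \bigcup_(y in range (g m))
      (g m @^-1` [set y] `&` (f ^~ y) @^-1` B)); last first.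
    apply/seteqP; split => x /=.
      by move=> Bx; exists (g m x) => //; exists x.
    by move=> [y _ [/= <-]].
  apply: fin_bigcup_measurable; first exact: fimfunP.
  move=> y _; apply: measurableI; first exact: measurable_sfunP.
  by rewrite -[X in measurable X]setTI; exact: fm.
move=> x _; apply: continuous_cvg; first exact: fc.
exact: (fine_cvg (gu x I)).
Qed.

End superposition.

(** * Doubling, product estimate and measurability *)

Section nonlinearity.
Context d (T : measurableType d) (R : realType).

(** The conditions hold at every point rather than almost everywhere, which keeps null sets out of
    the pointwise estimates; [regular_nonlinearity] provides such data. *)
Record odd_nonlinearity (f F : T -> R -> R) (c : R) : Prop := {
  nl_cont : forall x, continuous (f x);
  nl_nd : forall x, {homo f x : r t / r <= t};
  nl_odd : forall x t, f x (- t) = - f x t;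
  nl_measurable : forall t, measurable_fun [set: T] (f ^~ t);
  nl_F0 : forall x, F x 0 = 0;
  nl_even : forall x t, F x (- t) = F x t;
  nl_subgradient : forall x a b, f x a * (b - a) <= F x b - F x a;
  nl_c : 0 < c <= 1;
  nl_growth : forall x t, c * (t * f x t) <= F x t }.

Variables (f F : T -> R -> R) (c : R).
Hypothesis nl : odd_nonlinearity f F c.

Lemma nl_f0 x : f x 0 = 0.
Proof. by have := nl_odd nl x 0; rewrite oppr0; lra. Qed.

Lemma nl_ge0 x t : 0 <= F x t.
Proof. by have := nl_subgradient nl x 0 t; rewrite nl_f0 (nl_F0 nl); lra. Qed.

Lemma nl_norm x t : F x `|t| = F x t.
Proof. by case: ger0P => // _; rewrite (nl_even nl). Qed.

Lemma nl_f_ge0 x t : 0 <= t -> 0 <= f x t.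
Proof. by move=> t0; rewrite -(nl_f0 x) (nl_nd nl). Qed.

Lemma nl_f_norm x t : `|f x t| = f x `|t|.
Proof.
have [t0|t0] := ger0P t; first by rewrite ger0_norm // nl_f_ge0.
by rewrite (nl_odd nl) ler0_norm // -oppr_ge0 -(nl_odd nl) nl_f_ge0 // oppr_ge0 ltW.
Qed.

Lemma nl_le x a b : `|a| <= `|b| -> F x a <= F x b.
Proof.
move=> ab; rewrite -(nl_norm x a) -(nl_norm x b) -subr_ge0.
apply: le_trans (nl_subgradient nl x _ _).
by rewrite mulr_ge0 ?subr_ge0 // nl_f_ge0.
Qed.

Lemma nl_midpoint x a b : F x (2^-1 * (a + b)) <= 2^-1 * (F x a + F x b).
Proof.
have := nl_subgradient nl x (2^-1 * (a + b)) a.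
have := nl_subgradient nl x (2^-1 * (a + b)) b.
by lra.
Qed.

(* For [l = 1 + c / 2] the subgradient inequality and the growth condition *)
(* give [F (l t) - F t <= (l - 1) t f (l t) <= (l - 1) / (l c) F (l t)],   *)
(* where the factor on the right is at most [1 / 2].                       *)
Lemma nl_dilation x t : F x ((1 + c / 2) * t) <= 2 * F x t.
Proof.
have /andP[c0 c1] := nl_c nl.
set l := 1 + c / 2.
have l1 : 1 <= l by rewrite /l; lra.
have := nl_subgradient nl x (l * t) t.
have := nl_growth nl x (l * t).
have := nl_ge0 x (l * t); have := nl_ge0 x t.
set a := F x t; set b := F x (l * t); set p := f x (l * t) => a0 b0 gr sg.
have h : (l - 1) * (c * (l * t * p)) <= (l - 1) * b.
  by rewrite ler_wpM2l // subr_ge0.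
have h2 : l * c * (b - a) <= (l - 1) * b.
  apply: le_trans h.
  have -> : (l - 1) * (c * (l * t * p)) = l * c * (p * (l * t - t)) by ring.
  apply: ler_wpM2l; first by rewrite mulr_ge0 ?(ltW c0) // (le_trans _ l1).
  by move: sg; set y := l * t; lra.
have h3 : l * (b - a) <= 2^-1 * b.
  rewrite -(ler_pM2l c0); apply: le_trans (_ : (l - 1) * b <= _).
    by apply: le_trans h2; rewrite mulrA (mulrC c).
  by rewrite /l; lra.
have [ab|/ltW ba] := leP b a; first by lra.
have : b - a <= l * (b - a) by rewrite ler_peMl // subr_ge0.
by lra.
Qed.

(** Iterating [nl_dilation] [N] times costs [2 ^ N]; by Bernoulli's inequality [(1 + c / 2) ^ N]
    exceeds 2 as soon as [N > 2 / c]. *)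
Lemma nl_doubling : exists2 K : R, 0 <= K & forall x t, F x (2 * t) <= K * F x t.
Proof.
have /andP[c0 c1] := nl_c nl.
set l := 1 + c / 2.
have l0 : 0 <= l by rewrite /l; lra.
have iterate N x t : F x (l ^+ N * t) <= 2 ^+ N * F x t.
  elim: N => [|N IH]; first by rewrite !expr0 !mul1r.
  rewrite !exprS -!mulrA; apply: le_trans (nl_dilation _ _) _.
  by rewrite ler_wpM2l.
have bern N : 1 + N%:R * (c / 2) <= l ^+ N.
  elim: N => [|N IH]; first by rewrite mul0r addr0 expr0.
  rewrite exprS; apply: le_trans (_ : l * (1 + N%:R * (c / 2)) <= _).
    by rewrite -natr1 /l; have := ler0n R N; nra.
  by rewrite ler_wpM2l.
pose N := Num.bound (2 / c).
exists (2 ^+ N) => [|x t]; first by rewrite exprn_ge0.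
apply: le_trans (iterate N x t); apply: nl_le.
rewrite !normrM ler_wpM2r // !ger0_norm ?exprn_ge0 //.
apply: le_trans (bern N).
have : 2 / c < N%:R.
  by apply: archi_boundP; rewrite divr_ge0 // ltW.
by rewrite ltr_pdivrMr //; lra.
Qed.

Lemma nl_add : exists2 K : R, 0 <= K &
  forall x a b, F x (a + b) <= K * (F x a + F x b).
Proof.
have [K K0 HK] := nl_doubling; exists (K * 2^-1) => [|x a b].
  by rewrite mulr_ge0.
have -> : a + b = 2 * (2^-1 * (a + b)) by rewrite mulrA mulfV // mul1r.
apply: le_trans (HK _ _) _; rewrite -(mulrA K) ler_wpM2l //.
exact: nl_midpoint.
Qed.

(** Both factors are dominated by their values at the larger of [|a|] and [|b|], where
    [t * f x t <= F x t / c]. This stands in for Young's inequality with the conjugate function. *)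
Lemma nl_product x a b : `|f x a * b| <= c^-1 * (F x a + F x b).
Proof.
have /andP[c0 c1] := nl_c nl.
have H t : `|t| * f x `|t| <= c^-1 * F x t.
  by rewrite ler_pdivlMl // -nl_norm (nl_growth nl).
have c'0 : 0 <= c^-1 by rewrite invr_ge0 ltW.
have Ha := mulr_ge0 c'0 (nl_ge0 x a); have Hb := mulr_ge0 c'0 (nl_ge0 x b).
rewrite normrM nl_f_norm mulrDr; have [ba|/ltW ab] := leP `|b| `|a|.
  apply: le_trans (_ : c^-1 * F x a <= _); last by rewrite lerDl.
  by apply: le_trans (H a); rewrite mulrC ler_wpM2r // nl_f_ge0.
apply: le_trans (_ : c^-1 * F x b <= _); last by rewrite lerDr.
apply: le_trans (H b); rewrite mulrC ler_wpM2l //.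
exact: (nl_nd nl).
Qed.

Lemma nl_F_cont x : continuous (F x).
Proof.
move=> a.
have l0 : b - a @[b --> a] --> 0.
  by rewrite -(subrr a); apply: cvgB; [exact: cvg_id|exact: cvg_cst].
apply: (@squeeze_cvgr _ (nbhs a) _ _ (fun b => F x a + f x a * (b - a))
    (fun b => F x a + f x b * (b - a))).
- apply: nearW => b; have := nl_subgradient nl x a b.
  by have := nl_subgradient nl x b a; lra.
- rewrite -[X in _ --> X]addr0 -(mulr0 (f x a)).
  by apply: cvgD; [exact: cvg_cst|exact: cvgMr].
- rewrite -[X in _ --> X]addr0 -(mulr0 (f x a)).
  apply: cvgD; first exact: cvg_cst.
  by apply: cvgM => //; exact: (nl_cont nl).
Qed.

Lemma measurable_nl u : measurable_fun [set: T] u ->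
  measurable_fun [set: T] (fun x => f x (u x)).
Proof.
by apply: measurable_superposition; [exact: (nl_cont nl)|exact: (nl_measurable nl)].
Qed.

(** The subgradient inequality bounds each slice of the left Riemann sum on both sides, whatever the
    sign of [t], and the errors telescope. These sums exhibit [F x (u x)] as a limit of measurable
    functions. *)
Lemma nl_riemann x t m :
  let S := \sum_(i < m.+1) t / m.+1%:R * f x (i%:R * (t / m.+1%:R)) in
  F x t - t * f x t / m.+1%:R <= S <= F x t.
Proof.
set h := t / m.+1%:R.
have E : F x t = \sum_(i < m.+1) (F x (i.+1%:R * h) - F x (i%:R * h)).
  rewrite -(big_mkord xpredT (fun i => F x (i.+1%:R * h) - F x (i%:R * h))).
  rewrite telescope_sumr // mul0r (nl_F0 nl) subr0; congr (F x _).
  by rewrite /h mulrC divfK // pnatr_eq0.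
have E' : t * f x t / m.+1%:R = \sum_(i < m.+1) (h * f x (i.+1%:R * h) - h * f x (i%:R * h)).
  rewrite -(big_mkord xpredT (fun i => h * f x (i.+1%:R * h) - h * f x (i%:R * h))).
  rewrite (telescope_sumr (fun i => h * f x (i%:R * h))) // mul0r nl_f0 mulr0 subr0.
  rewrite (_ : m.+1%:R * h = t); first by rewrite /h; ring.
  by rewrite /h mulrC divfK // pnatr_eq0.
rewrite /= E E' -sumrB; apply/andP; split; apply: ler_sum => i _.
  have := nl_subgradient nl x (i.+1%:R * h) (i%:R * h).
  by rewrite -natr1; lra.
have := nl_subgradient nl x (i%:R * h) (i.+1%:R * h).
by rewrite -natr1; lra.
Qed.

Lemma measurable_nl_F u : measurable_fun [set: T] u ->
  measurable_fun [set: T] (fun x => F x (u x)).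
Proof.
move=> um.
pose S m x := \sum_(i < m.+1) u x / m.+1%:R * f x (i%:R * (u x / m.+1%:R)).
apply: (@measurable_fun_cvg _ _ _ _ S) => [m|x _].
  apply: measurable_sum => i; apply: measurable_funM.
    exact: measurable_funM.
  apply: (measurable_nl (u := fun x => i%:R * (u x / m.+1%:R))).
  by apply: measurable_funM => //; exact: measurable_funM.
apply: (@squeeze_cvgr _ _ _ _ (fun m => F x (u x) - u x * f x (u x) / m.+1%:R) (fun=> F x (u x))).
- by apply: nearW => m; exact: nl_riemann.
- rewrite -[X in _ --> X]subr0; apply: cvgB; first exact: cvg_cst.
  rewrite -[X in _ --> X](mulr0 (u x * f x (u x))); apply: cvgMr.
  exact: cvg_harmonic.
- exact: cvg_cst.
Qed.

End nonlinearity.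

(** * Weak solutions *)

Lemma limn_einf_le {R : realType} (u : nat -> \bar R) (b : nat -> R) (B : R) :
  (forall k, (u k <= (b k)%:E)%E) -> b k @[k --> \oo] --> B ->
  (limn_einf u <= B%:E)%E.
Proof.
move=> ub bB; have bB' : (b k)%:E @[k --> \oo] --> B%:E by apply: cvg_EFin => //; exact: nearW.
rewrite limn_einf_lim -(cvg_lim _ bB') //; apply: lee_lim.
- exact: is_cvg_einfs.
- by apply/cvg_ex; eexists; exact: bB'.
- apply: nearW => k; apply: le_trans (ub k).
  by apply: ereal_inf_lbound; exists k => /=.
Qed.

(** Serves to pass to the limit in the potential energy, where no dominating function is at hand. *)
Lemma fatou_bound d (T : measurableType d) (R : realType)
    (mu : {measure set T -> \bar R}) (g : nat -> T -> R) (h : T -> R)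
    (b : nat -> R) (B : R) :
  (forall k, mu.-integrable [set: T] (EFin \o g k)) ->
  (forall k x, 0 <= g k x) ->
  measurable_fun [set: T] h -> (forall x, 0 <= h x) ->
  (\forall x \ae mu, g k x @[k --> \oo] --> h x) ->
  (forall k, \int[mu]_x g k x <= b k) -> b k @[k --> \oo] --> B ->
  mu.-integrable [set: T] (EFin \o h) /\ \int[mu]_x h x <= B.
Proof.
move=> ig g0 mh h0 [N [mN N0 sN]] gb bB.
have mg k : measurable_fun [set: T] (g k) by apply/measurable_EFinP; exact: measurable_int (ig k).
have mCN : measurable (~` N) by exact: measurableC.
have aeN : \forall x \ae mu, ~ N x by exists N; split => // x /= /contrapT.
pose g' k : T -> R := g k \_ (~` N).
pose h' : T -> R := h \_ (~` N).
have mg' k : measurable_fun [set: T] (g' k).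
  apply: (measurable_restrictT _ mCN).1; exact: measurable_funTS (mg k).
have mh' : measurable_fun [set: T] h'.
  apply: (measurable_restrictT _ mCN).1; exact: measurable_funTS mh.
have g'0 k x : 0 <= g' k x by rewrite /g' patchE; case: ifP.
have h'0 x : 0 <= h' x by rewrite /h' patchE; case: ifP.
have hh' : (\int[mu]_x (h x)%:E = \int[mu]_x (h' x)%:E)%E.
  apply: ae_eq_integral => //; try exact/measurable_EFinP.
  by apply: filterS aeN => x Nx _; rewrite /h' patchE mem_set.
have key : (\int[mu]_x (h x)%:E <= B%:E)%E.
  rewrite hh'.
  have -> : (\int[mu]_x (h' x)%:E = \int[mu]_x limn_einf (fun k => (g' k x)%:E))%E.
    apply: eq_integral => x _; apply/esym.
    have l : (g' k x)%:E @[k --> \oo] --> (h' x)%:E.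
      apply: cvg_EFin; first exact: nearW.
      have [Nx|Nx] := pselect (N x).
        have xN : (x \in ~` N) = false by apply: memNset => /(_ Nx).
        rewrite /g' /h' patchE xN; under eq_fun do rewrite patchE xN.
        exact: cvg_cst.
      have xN : (x \in ~` N) = true by exact: mem_set.
      rewrite /g' /h' patchE xN; under eq_fun do rewrite patchE xN.
      by apply: contrapT => nl; apply: Nx; exact: sN.
    by rewrite (cvg_limn_einf_sup l).1.
  have F : (\int[mu]_x limn_einf (fun k => (g' k x)%:E) <=
      limn_einf (fun k => \int[mu]_x (g' k x)%:E))%E.
    apply: fatou => // [k|k x _]; first exact/measurable_EFinP.
    by rewrite lee_fin.
  apply: (le_trans F).
  apply: limn_einf_le bB => k; apply: le_trans (_ : ((\int[mu]_x g k x)%:E <= _)%E); last first.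
    by rewrite lee_fin.
  rewrite /Rintegral fineK; last exact: (integrable_fin_num measurableT (ig k)).
  apply: ge0_le_integral => //.
  - by move=> x _; rewrite lee_fin.
  - exact/measurable_EFinP.
  - exact/measurable_EFinP.
  - by move=> x _; rewrite lee_fin /g' patchE; case: ifP.
have ih : mu.-integrable [set: T] (EFin \o h).
  apply/integrableP; split; first exact/measurable_EFinP.
  under eq_integral do rewrite /= ger0_norm //.
  by apply: le_lt_trans key _; rewrite ltry.
split => //; rewrite -lee_fin /Rintegral fineK //.
exact: (integrable_fin_num measurableT ih).
Qed.

Lemma cvg_Rintegral_dominated d (T : measurableType d) (R : realType)
    (mu : {measure set T -> \bar R}) (g : nat -> T -> R) (h k : T -> R) :
  (forall m, measurable_fun [set: T] (g m)) -> measurable_fun [set: T] h ->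
  (forall x, g m x @[m --> \oo] --> h x) ->
  mu.-integrable [set: T] (EFin \o k) -> (forall m x, `|g m x| <= k x) ->
  \int[mu]_x g m x @[m --> \oo] --> \int[mu]_x h x.
Proof.
move=> mg mh gh ik gk.
have [||||ih _ l] := @dominated_convergence _ _ _ mu _ measurableT
  (fun m x => (g m x)%:E) (EFin \o h) (EFin \o k) _ _ _ ik.
- by move=> m; exact/measurable_EFinP.
- exact/measurable_EFinP.
- by apply: aeW => x _; apply: cvg_EFin; [exact: nearW|exact: gh].
- by apply: aeW => x m _; rewrite lee_fin.
apply: fine_cvg; rewrite fineK //.
exact: (integrable_fin_num measurableT ih).
Qed.

Section weak_solutions.
Context d (T : measurableType d) (R : realType).
Variable mu : {measure set T -> \bar R}.
Variables (phi : nat -> T -> R) (wt : nat -> R) (f F : T -> R -> R) (c : R).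
Hypothesis basis : hilbert_basis mu phi.
Hypothesis wt_gt0 : forall k, 0 < wt k.
Hypothesis wt_nd : {homo wt : j k / (j <= k)%N >-> j <= k}.
Hypothesis nl : odd_nonlinearity f F c.
Local Notation L2 := (Lfun mu 2%:E).
Local Notation inner := (inner mu).
Local Notation multiplier := (multiplier mu phi wt).
Implicit Types (u v w q z : T -> R).

Definition integrable_energy u :=
  mu.-integrable [set: T] (EFin \o (fun x => F x (u x))).

(** The image [w] of [u] under the multiplier is carried along, so that no value of the operator has
    to be chosen. *)
Definition finite_energy u w := multiplier u w /\ integrable_energy u.

Definition weak_sol z u w := finite_energy u w /\
  forall v q, finite_energy v q ->
    inner w q + \int[mu]_x (f x (u x) * v x) = inner z v.

Lemma finite_energy_L2 u w : finite_energy u w -> u \in L2.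
Proof. by move=> [[]]. Qed.

Lemma finite_energy_measurable u w :
  finite_energy u w -> measurable_fun [set: T] u.
Proof. by move=> /finite_energy_L2; exact: Lfun_measurable. Qed.

Lemma integrable_energy_le u v : measurable_fun [set: T] u ->
  (forall x, `|u x| <= `|v x|) -> integrable_energy v -> integrable_energy u.
Proof.
move=> um uv; apply: le_integrable => //.
  by apply/measurable_EFinP; exact: (measurable_nl_F nl).
move=> x _ /=; rewrite lee_fin !ger0_norm ?(nl_ge0 nl) //.
exact: (nl_le nl).
Qed.

Lemma integrable_energyD u v :
  measurable_fun [set: T] u -> measurable_fun [set: T] v ->
  integrable_energy u -> integrable_energy v ->
  integrable_energy (fun x => u x + v x).
Proof.
move=> um vm iu iv; have [K K0 HK] := nl_add nl.
apply: le_integrable (integrableZl measurableT K (integrableD measurableT iu iv)) => //.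
  by apply/measurable_EFinP; apply: (measurable_nl_F nl); exact: measurable_funD.
move=> x _ /=; rewrite lee_fin ger0_norm ?(nl_ge0 nl) //.
by apply: le_trans (HK _ _ _) _; rewrite ler_norm.
Qed.

Lemma integrable_nl_mul u v :
  measurable_fun [set: T] u -> measurable_fun [set: T] v ->
  integrable_energy u -> integrable_energy v ->
  mu.-integrable [set: T] (EFin \o (fun x => f x (u x) * v x)).
Proof.
move=> um vm iu iv.
apply: le_integrable (integrableZl measurableT c^-1 (integrableD measurableT iu iv)) => //.
  by apply/measurable_EFinP; apply: measurable_funM => //; exact: (measurable_nl nl).
move=> x _ /=; rewrite lee_fin.
by apply: le_trans (nl_product nl _ _ _) _; rewrite ler_norm.
Qed.

Lemma finite_energyD u w v q : finite_energy u w -> finite_energy v q ->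
  finite_energy (fun x => u x + v x) (fun x => w x + q x).
Proof.
move=> hu hv; split; first by apply: multiplierD => //; [case: hu|case: hv].
apply: integrable_energyD; [exact: finite_energy_measurable hu
  |exact: finite_energy_measurable hv|by case: hu|by case: hv].
Qed.

Lemma finite_energyZ (t : R) u w : `|t| <= 1 -> finite_energy u w ->
  finite_energy (fun x => t * u x) (fun x => t * w x).
Proof.
move=> t1 hu; split; first by apply: multiplierZ; case: hu.
have um := finite_energy_measurable hu.
apply: (@integrable_energy_le _ u); [exact: measurable_funM| |by case: hu].
by move=> x; rewrite normrM ler_piMl.
Qed.

Lemma finite_energyB u w v q : finite_energy u w -> finite_energy v q ->
  finite_energy (fun x => u x - v x) (fun x => w x - q x).
Proof.
move=> hu hv.
have := finite_energyD hu (@finite_energyZ (-1) v q _ hv).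
rewrite normrN1 => /(_ (lexx _)).
by under eq_fun do rewrite mulN1r; under [X in finite_energy _ X]eq_fun do rewrite mulN1r.
Qed.

Lemma finite_energy0 : finite_energy (fun=> 0) (fun=> 0).
Proof.
split; first by split; rewrite ?L2_0 // => k; rewrite inner0l mulr0.
rewrite /integrable_energy (_ : EFin \o _ = cst 0%E); first exact: integrable0.
by apply/funext => x /=; rewrite (nl_F0 nl).
Qed.

(** Test both equations with [u - u'] and subtract: monotonicity of [f] gives the nonlinear term a
    sign. *)
Lemma weak_sol_stability z z' u w u' w' :
  z \in L2 -> z' \in L2 -> weak_sol z u w -> weak_sol z' u' w' ->
  inner (fun x => w x - w' x) (fun x => w x - w' x) <=
  inner (fun x => z x - z' x) (fun x => u x - u' x).
Proof.
move=> hz hz' [hu su] [hu' su'].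
have hd := finite_energyB hu hu'.
have e := su _ _ hd; have e' := su' _ _ hd.
have [[_ hw _] iu] := hu; have [[_ hw' _] iu'] := hu'.
have [[hdu hdw _] id] := hd.
have um := finite_energy_measurable hu; have um' := finite_energy_measurable hu'.
have dm := finite_energy_measurable hd.
rewrite innerBl // innerBl // -e -e' opprD addrACA lerDl.
rewrite -RintegralB //; [|exact: integrable_nl_mul..].
apply: Rintegral_ge0 => x _; rewrite -mulrBl.
have [uu|/ltW uu] := leP (u x) (u' x).
  by rewrite mulr_le0 // subr_le0 //; exact: (nl_nd nl).
by rewrite mulr_ge0 // subr_ge0 //; exact: (nl_nd nl).
Qed.

(** With [W] the squared norm of [w - w'], stability and [multiplier_dual] give [W <= K * sqrt W],
    hence [sqrt W <= K]; the Poincare inequality returns to [u - u']. *)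
Lemma weak_sol_dual_bound z z' u w u' w' N :
  z \in L2 -> z' \in L2 -> weak_sol z u w -> weak_sol z' u' w' ->
  wt 0 ^+ 2 * inner (fun x => u x - u' x) (fun x => u x - u' x) <=
  (Num.sqrt (inner (fun x => z x - z' x) (fun x => z x - z' x)) / wt N +
    (\sum_(k < N) `|inner z (phi k) - inner z' (phi k)|) / wt 0) ^+ 2.
Proof.
move=> hz hz' su su'; pose dz x := z x - z' x; rewrite -/dz.
have -> : \sum_(k < N) `|inner z (phi k) - inner z' (phi k)| =
    \sum_(k < N) `|inner dz (phi k)|.
  by apply: eq_bigr => k _; rewrite innerBl //; case: basis.
have hdz : dz \in L2 by exact: L2B.
have [[m _] _] := su; have [[m' _] _] := su'.
have md := multiplierB basis m m'.
apply: le_trans (multiplier_poincare basis wt_gt0 wt_nd md) _.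
have st := weak_sol_stability hz hz' su su'.
have du := multiplier_dual basis wt_gt0 wt_nd N md hdz.
set K := (_ + _) in du *; set W := inner _ _ in st du *.
have W0 : 0 <= W by exact: inner_ge0.
have : Num.sqrt W <= K.
  have [s0|s0] := eqVneq (Num.sqrt W) 0.
    rewrite s0 addr_ge0 // ?divr_ge0 ?sumr_ge0 ?sqrtr_ge0 ?ltW //.
  have s1 : 0 < Num.sqrt W by rewrite lt_def s0 sqrtr_ge0.
  rewrite -(ler_pM2r s1) -expr2 sqr_sqrtr //.
  exact: le_trans st du.
move=> WK; rewrite -(sqr_sqrtr W0) lerXn2r ?nnegrE ?sqrtr_ge0 //.
exact: le_trans (sqrtr_ge0 _) WK.
Qed.

End weak_solutions.

(** * Existence of weak solutions by energy minimization *)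

Section existence.
Context d (T : measurableType d) (R : realType).
Variable mu : {measure set T -> \bar R}.
Variables (phi : nat -> T -> R) (wt : nat -> R) (f F : T -> R -> R) (c : R).
Hypothesis basis : hilbert_basis mu phi.
Hypothesis wt_gt0 : forall k, 0 < wt k.
Hypothesis wt_nd : {homo wt : j k / (j <= k)%N >-> j <= k}.
Hypothesis nl : odd_nonlinearity f F c.
Variable z : T -> R.
Local Notation L2 := (Lfun mu 2%:E).
Hypothesis hz : z \in L2.
Local Notation inner := (inner mu).
Local Notation multiplier := (multiplier mu phi wt).
Local Notation finite_energy := (finite_energy mu phi wt F).
Local Notation weak_sol := (weak_sol mu phi wt f F).
Implicit Types (u v w q : T -> R).

(** The energy whose Euler-Lagrange equation is the weak equation. *)
Let G u w := 2^-1 * inner w w + \int[mu]_x F x (u x) - inner z u.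

Let ib := inner z z / wt 0 ^+ 2.

Let wt2 : 0 < wt 0 ^+ 2. Proof. exact: exprn_gt0. Qed.

(** Coercivity: Young's inequality with parameter [2 / wt 0 ^ 2], then the Poincare inequality,
    absorb [inner z u] into a quarter of [inner w w] at the cost [ib]. *)
Let G_lower u w : finite_energy u w -> 4^-1 * inner w w - ib <= G u w.
Proof.
move=> [m iu]; have [hu hw _] := m.
have F0 : 0 <= \int[mu]_x F x (u x).
  by apply: Rintegral_ge0 => x _; exact: (nl_ge0 nl).
have t0 : 0 < 2 / wt 0 ^+ 2 by rewrite divr_gt0.
have := inner_young hz hu t0.
have := multiplier_poincare basis wt_gt0 wt_nd m.
have -> : (2 / wt 0 ^+ 2)^-1 * inner u u = 2^-1 * (wt 0 ^+ 2 * inner u u).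
  by field; rewrite gt_eqF.
have -> : 2 / wt 0 ^+ 2 * inner z z = 2 * ib by rewrite /ib; ring.
by rewrite /G; lra.
Qed.

Let values := [set r : R | exists u w, finite_energy u w /\ r = G u w].

Let values_inf : has_inf values.
Proof.
split.
  exists (G (fun=> 0) (fun=> 0)), (fun=> 0), (fun=> 0); split => //.
  exact: (finite_energy0 _ _ _ nl).
exists (- ib) => _ [u [w [hu ->]]]; apply: le_trans (G_lower hu).
by have := inner_ge0 mu w; lra.
Qed.

Let I := inf values.

Let I_le u w : finite_energy u w -> I <= G u w.
Proof.
by move=> hu; apply: ge_inf; [exact: values_inf.2|exists u, w].
Qed.

(** Sublevel sets are taken in the variable [w], in which the energy is coercive; [w] determines [u]
    up to a null set. *)
Let C (m : nat) : set (T -> R) :=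
  [set w | exists2 u, finite_energy u w & G u w <= I + m.+1%:R^-1].

(** The quadratic and linear terms converge in norm; Fatou's lemma along an almost everywhere
    convergent selection handles the potential term. *)
Let C_closed m (v : nat -> T -> R) w : (forall k, C m (v k)) -> w \in L2 ->
  inner (fun x => v k x - w x) (fun x => v k x - w x) @[k --> \oo] --> 0 ->
  C m w.
Proof.
move=> vC hw vw.
have /choice[s sP] k : exists u, finite_energy u (v k) /\
    G u (v k) <= I + m.+1%:R^-1.
  by have [u hu uG] := vC k; exists u.
have su k : finite_energy (s k) (v k) by have [] := sP k.
have sG k : G (s k) (v k) <= I + m.+1%:R^-1 by have [] := sP k.
have hs k : s k \in L2 by case: (su k) => -[].
have hv k : v k \in L2 by case: (su k) => -[].
have [u um] := multiplier_surj basis wt_gt0 wt_nd hw; have [hu _ _] := um.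
have us : inner (fun x => s k x - u x) (fun x => s k x - u x) @[k --> \oo] --> 0.
  have l : (wt 0 ^+ 2)^-1 * inner (fun x => v k x - w x) (fun x => v k x - w x)
      @[k --> \oo] --> 0.
    by rewrite -[X in _ --> X](mulr0 (wt 0 ^+ 2)^-1); exact: cvgMr.
  apply: (@squeeze_cvgr _ _ _ _ (fun=> 0) _ _ _ 0 _ l); last exact: cvg_cst.
  apply: nearW => k; rewrite inner_ge0 /= ler_pdivlMl //.
  apply: (multiplier_poincare basis wt_gt0 wt_nd).
  by apply: (multiplierB basis) => //; case: (su k).
have [r rk ru] := cvg_subsequence_ae hs hu us.
have rcvg (a : nat -> R) l : a k @[k --> \oo] --> l -> a (r k) @[k --> \oo] --> l.
  move=> al; apply: (cvg_comp r a _ al) => A [N _ NA].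
  by exists N => // k /= Nk; apply: NA => /=; exact: leq_trans Nk (rk k).
pose b k := I + m.+1%:R^-1 - 2^-1 * inner (v k) (v k) + inner z (s k).
pose B := I + m.+1%:R^-1 - 2^-1 * inner w w + inner z u.
have bB : b k @[k --> \oo] --> B.
  apply: cvgD; last first.
    rewrite innerC; under eq_fun do rewrite innerC.
    exact: cvg_inner.
  apply: cvgB; first exact: cvg_cst.
  apply: cvgMr.
  have -> : (fun k => inner (v k) (v k)) = (fun k =>
      inner (fun x => v k x - w x) (fun x => v k x - w x) +
      (2 * inner (v k) w - inner w w)).
    by apply/funext => k; rewrite inner_sqrB //; ring.
  rewrite [X in _ --> X](_ : _ = 0 + (2 * inner w w - inner w w)); last by ring.
  apply: cvgD => //; apply: cvgB; last exact: cvg_cst.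
  by apply: cvgMr; exact: cvg_inner.
have [|||||||iu uB] := @fatou_bound _ T R mu (fun k x => F x (s (r k) x))
    (fun x => F x (u x)) (b \o r) B.
- by move=> k; case: (su (r k)).
- by move=> k x; exact: (nl_ge0 nl).
- by apply: (measurable_nl_F nl); exact: Lfun_measurable hu.
- by move=> x; exact: (nl_ge0 nl).
- apply: filterS ru => x ux; apply: continuous_cvg => //.
  exact: (nl_F_cont nl).
- move=> k; rewrite /comp /b /=; have := sG (r k).
  by rewrite /G; move: (m.+1%:R^-1) => e; lra.
- exact: rcvg.
exists u => //; move: uB; rewrite /G /B; move: (m.+1%:R^-1) => e; lra.
Qed.

Lemma energy_minimizer : exists u w, finite_energy u w /\
  forall v q, finite_energy v q ->
    2^-1 * inner w w + \int[mu]_x F x (u x) - inner z u <=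
    2^-1 * inner q q + \int[mu]_x F x (v x) - inner z v.
Proof.
(* The bound is [G_lower] at level [m = 0], where the energy is at most [I + 1]. *)
have [] := @nested_convex_inter _ T R mu C (4 * (I + 1 + ib)).
- by move=> m w [u [[]]].
- move=> m; have e0 : 0 < m.+1%:R^-1 :> R by rewrite invr_gt0 ltr0n.
  have [_ [u [w [hu ->]]] rI] := inf_adherent e0 values_inf.
  by exists w, u => //; exact: ltW.
- move=> m l ml w [u hu uG]; exists u => //; apply: le_trans uG _.
  by rewrite lerD2l lef_pV2 ?posrE ?ltr0n // ler_nat.
- move=> w [u hu]; rewrite invr1; have := G_lower hu; lra.
- move=> m w w' [u hu uG] [u' hu' uG'].
  have h2 : finite_energy (fun x => 2^-1 * (u x + u' x)) (fun x => 2^-1 * (w x + w' x)).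
    apply: (finite_energyZ basis nl); last exact: (finite_energyD basis nl).
    by rewrite ger0_norm ?invr_ge0 // invf_le1 // ler1n.
  exists (fun x => 2^-1 * (u x + u' x)) => //.
  have [[hu2 hw2 _] iu] := hu; have [[hu2' hw2' _] iu'] := hu'.
  have [_ i2] := h2.
  have Fm : \int[mu]_x F x (2^-1 * (u x + u' x)) <=
      2^-1 * (\int[mu]_x F x (u x) + \int[mu]_x F x (u' x)).
    have iD := integrableD measurableT iu iu'.
    rewrite -RintegralD // -RintegralZl //; apply: le_Rintegral => //.
      exact: (integrableZl measurableT 2^-1 iD).
    by move=> x _; exact: (nl_midpoint nl).
  have := inner_mid hw2 hw2'; move: Fm uG uG'.
  rewrite /G (innerZr 2^-1 (L2D hu2 hu2') hz) innerDr //; move: (m.+1%:R^-1) => e; lra.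
- exact: C_closed.
move=> w wC; have [u hu uG] := wC 0%N.
(* Each [C m] may supply another preimage of [w]; all of them agree almost everywhere, so the energy
   is the same. *)
have uGm m : G u w <= I + m.+1%:R^-1.
  have [v hv vG] := wC m.
  have uv : \forall x \ae mu, u x = v x.
    apply: (multiplier_unique basis wt_gt0 hu.1 hv.1); exact: nearW.
  suff -> : G u w = G v w by [].
  have [[hu2 _ _] _] := hu; have [[hv2 _ _] _] := hv.
  rewrite /G; congr (_ + _ - _); last by apply: eq_inner_ae => //; exact: nearW.
  rewrite /Rintegral; congr fine; apply: ae_eq_integral => //.
  - by apply/measurable_EFinP; apply: (measurable_nl_F nl); exact: Lfun_measurable hu2.
  - by apply/measurable_EFinP; apply: (measurable_nl_F nl); exact: Lfun_measurable hv2.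
  - by apply: filterS uv => x ->.
exists u, w; split => // v q hv; apply: le_trans (I_le hv).
have l : I + m.+1%:R^-1 @[m --> \oo] --> I.
  rewrite -[X in _ --> X]addr0; apply: cvgD; first exact: cvg_cst.
  exact: cvg_harmonic.
rewrite -(cvg_lim _ l) //; apply: limr_ge; first by apply/cvg_ex; eexists; exact: l.
exact: nearW.
Qed.

(* Dividing [G (u + t v) - G u >= 0] by [t > 0] and using the subgradient *)
(* inequality gives the Euler-Lagrange inequality with [f (u + t v)] in   *)
(* place of [f u]; then t tends to 0.                                     *)
Lemma weak_sol_exists : exists u w, weak_sol z u w.
Proof.
have [u [w [hu umin]]] := energy_minimizer.
exists u, w; split => //.
have um := finite_energy_measurable hu.
have [[hu2 hw2 _] iu] := hu.
have half v q : finite_energy v q ->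
    0 <= inner w q + \int[mu]_x (f x (u x) * v x) - inner z v.
  move=> hv; have vm := finite_energy_measurable hv.
  have [[hv2 hq2 _] iv] := hv.
  pose t m : R := m.+1%:R^-1.
  have t0 m : 0 < t m by rewrite invr_gt0 ltr0n.
  have t1 m : `|t m| <= 1 by rewrite gtr0_norm // invf_le1 ?ltr0n // ler1n.
  have tl : t m @[m --> \oo] --> 0 by exact: cvg_harmonic.
  have step m : 0 <= inner w q + t m * (2^-1 * inner q q) +
      \int[mu]_x (f x (u x + t m * v x) * v x) - inner z v.
    have htv := finite_energyZ basis nl (t1 m) hv.
    have hp := finite_energyD basis nl hu htv.
    have pm := finite_energy_measurable hp.
    have [_ ip] := hp.
    have ifv := integrable_nl_mul nl pm vm ip iv.
    have Fi : \int[mu]_x F x (u x + t m * v x) - \int[mu]_x F x (u x) <=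
        t m * \int[mu]_x (f x (u x + t m * v x) * v x).
      rewrite -RintegralB // -RintegralZl //; apply: le_Rintegral => //.
      - exact: (integrableB measurableT ip iu).
      - exact: (integrableZl measurableT (t m) ifv).
      move=> x _; have := nl_subgradient nl x (u x + t m * v x) (u x).
      by lra.
    have := umin _ _ hp.
    rewrite inner_sqrD ?L2Z // innerZr // innerZl ?L2Z // innerZr //.
    rewrite innerDr ?L2Z // innerZr // => H.
    rewrite -(pmulr_rge0 _ (t0 m)); move: Fi H.
    set J := \int[mu]_x (f x _ * _); set A := \int[mu]_x _; set B := \int[mu]_x _.
    by lra.
  have l : inner w q + t m * (2^-1 * inner q q) +
      \int[mu]_x (f x (u x + t m * v x) * v x) - inner z v @[m --> \oo] -->
      inner w q + \int[mu]_x (f x (u x) * v x) - inner z v.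
    apply: cvgB; last exact: cvg_cst.
    apply: cvgD.
      rewrite -[X in _ --> X]addr0; apply: cvgD; first exact: cvg_cst.
      by rewrite -[X in _ --> X](mul0r (2^-1 * inner q q)); exact: cvgMl.
    (* As [t m <= 1] and [f] is odd and nondecreasing, [f x (|u x| + |v x|) * v x] dominates the
       integrands in absolute value. *)
    have am : measurable_fun [set: T] (fun x => `|u x| + `|v x|).
      by apply: measurable_funD; exact: measurableT_comp.
    have ia : integrable_energy mu F (fun x => `|u x| + `|v x|).
      apply: (integrable_energyD nl); try exact: measurableT_comp.
        by apply: (integrable_energy_le nl) iu => [|x]; [exact: measurableT_comp|rewrite normr_id].
      by apply: (integrable_energy_le nl) iv => [|x]; [exact: measurableT_comp|rewrite normr_id].
    have ik := integrable_norm (integrable_nl_mul nl am vm ia iv).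
    have mp m : measurable_fun [set: T] (fun x => u x + t m * v x).
      by apply: measurable_funD => //; exact: measurable_funM.
    apply: (cvg_Rintegral_dominated _ _ _ ik).
    - by move=> m; apply: measurable_funM => //; exact: (measurable_nl nl).
    - by apply: measurable_funM => //; exact: (measurable_nl nl).
    - move=> x; apply: cvgMl; apply: continuous_cvg; first exact: (nl_cont nl).
      rewrite -[X in _ --> X]addr0; apply: cvgD; first exact: cvg_cst.
      by rewrite -[X in _ --> X](mul0r (v x)); exact: cvgMl.
    move=> m x; rewrite /= !normrM ler_wpM2r // !(nl_f_norm nl).
    apply: (nl_nd nl); rewrite [leRHS]ger0_norm ?addr_ge0 //.
    by apply: le_trans (ler_normD _ _) _; rewrite lerD2l normrM ler_piMl.
  rewrite -(cvg_lim _ l) //; apply: limr_ge; first by apply/cvg_ex; eexists; exact: l.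
  exact: nearW.
move=> v q hv; apply/eqP; rewrite eq_le; apply/andP; split; last first.
  by rewrite -subr_ge0 half.
have [[hv2 hq2 _] iv] := hv.
(* The inequality at [-v] is the reverse inequality at [v]. *)
have := half _ _ (finite_energyZ basis nl (t := -1) _ hv).
rewrite normrN1 => /(_ (lexx _)).
rewrite !innerZr //.
rewrite (_ : \int[mu]_x _ = - \int[mu]_x (f x (u x) * v x)).
  by lra.
rewrite -[RHS]mulN1r -RintegralZl //.
  by apply: eq_Rintegral => x _; ring.
have vm := finite_energy_measurable hv; exact: (integrable_nl_mul nl um vm iu iv).
Qed.

End existence.

(** * The Lebesgue measure on a domain *)

Section measurable_ae.
Context d (T : measurableType d) (R : realType).
Variable mu : {measure set T -> \bar R}.
Hypothesis mu_complete : measure_is_complete mu.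
Implicit Types g h : T -> R.

Lemma measurable_ae g h : (\forall x \ae mu, g x = h x) ->
  measurable_fun [set: T] g -> measurable_fun [set: T] h.
Proof.
move=> gh /measurable_EFinP mg; apply/measurable_EFinP.
apply: (ae_measurable_fun mu_complete _ mg).
by apply: filterS gh => x /= -> _.
Qed.

Lemma integrable_ae_eq g h : (\forall x \ae mu, g x = h x) ->
  mu.-integrable [set: T] (EFin \o g) -> mu.-integrable [set: T] (EFin \o h).
Proof.
move=> gh /integrableP[mg ig].
have mh : measurable_fun [set: T] (EFin \o h).
  apply/measurable_EFinP; apply: (measurable_ae gh); exact/measurable_EFinP.
apply/integrableP; split => //.
rewrite (ae_eq_integral (fun x => `|(EFin \o g) x|%E)) //.
- exact: measurableT_comp.
- exact: measurableT_comp.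
- by apply: filterS gh => x /= -> _.
Qed.

Lemma Rintegral_ae_eq g h : (\forall x \ae mu, g x = h x) ->
  measurable_fun [set: T] g -> \int[mu]_x g x = \int[mu]_x h x.
Proof.
move=> gh mg; rewrite /Rintegral; congr fine; apply: ae_eq_integral => //.
- exact/measurable_EFinP.
- by apply/measurable_EFinP; exact: (measurable_ae gh).
- by apply: filterS gh => x -> _.
Qed.

End measurable_ae.

Section domain_measure.
Context {R : realType} {n : nat} {Omega : set 'rV[R]_n.+1}.
Local Notation mu := (lebesgue_on Omega).

Lemma lebesgue_on_complete : measure_is_complete mu.
Proof. exact: (@measure_is_complete_caratheodory _ _ (lebesgue_outer Omega)). Qed.

Lemma lebesgue_on_fin : bounded_set Omega -> mu [set: domain Omega] \is a fin_num.
Proof.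
move=> [M [Mr bM]].
pose K : R := `|M| + 1.
have OK x i : Omega x -> `|x ord0 i| <= K.
  move=> Ox; apply: le_trans (_ : `|x| <= _).
    rewrite [leRHS]mx_normrE.
    exact: (le_bigmax 0 (fun ij => `|x ij.1 ij.2|) (ord0, i)).
  by apply: bM => //; rewrite /K ltr_pwDr // ler_norm.
rewrite ge0_fin_numE; last exact: measure_ge0.
(* Boxes are open at their lower corner, hence [- K - 1]; all boxes after the first have volume
   0. *)
pose C (k : nat) : 'rV[R]_n.+1 * 'rV[R]_n.+1 :=
  if k is 0 then (\row__ (- K - 1), \row__ K) else (0, 0).
apply: (@le_lt_trans _ _ (\sum_(k <oo) box_volume (C k))%E).
  apply: ereal_inf_lbound; exists C => // x [_ Ox]; exists 0%N => // i.
  rewrite !mxE; have := OK x i Ox; rewrite ler_norml => /andP[? ?].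
  by apply/andP; split => //; lra.
rewrite (nneseries_split 0 1); last by move=> k _; exact: box_volume_ge0.
rewrite add0n big_nat1 eseries0 ?adde0 ?ltry // => k k1 _.
rewrite /C; case: k k1 => // k _.
by rewrite /box_volume big_ord_recl /= !mxE subrr maxxx mul0r.
Qed.

Lemma L2norm_cvg0 (e : nat -> domain Omega -> R) :
  (forall k, e k \in Lfun mu 2%:E) ->
  (L2norm (e k) @[k --> \oo] --> 0%E) <-> (inner mu (e k) (e k) @[k --> \oo] --> 0).
Proof.
move=> he; have E : (fun k => L2norm (e k)) = (fun k => (Num.sqrt (inner mu (e k) (e k)))%:E).
  by apply/funext => k; exact: L2norm_inner.
rewrite E; split => [/fine_cvg l|l].
  have -> : (fun k => inner mu (e k) (e k)) =
      (fun k => Num.sqrt (inner mu (e k) (e k)) * Num.sqrt (inner mu (e k) (e k))).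
    by apply/funext => k; rewrite -expr2 sqr_sqrtr // inner_ge0.
  by rewrite -[X in _ --> X](mul0r (0 : R)); exact: (cvgM l l).
apply: cvg_EFin; first exact: nearW.
rewrite -[X in _ --> X]sqrtr0; apply: continuous_cvg => //.
exact: sqrt_continuous.
Qed.

Lemma L2_Lfun (u : L2 Omega) : (u : domain Omega -> R) \in Lfun mu 2%:E.
Proof.
rewrite inE; apply/andP; split; rewrite inE /=; first exact: measurable_L2fun.
exact: (@Lebesgue_finite _ _ _ _ _ _ (u : LspaceType2 mu)).
Qed.

(** Elements of [L2] are classes read through a chosen representative, so a function can be matched
    only almost everywhere. *)
Lemma L2_class (u : domain Omega -> R) : u \in Lfun mu 2%:E ->
  exists v : L2 Omega, \forall x \ae mu, v x = u x.
Proof.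
move=> hu; have um : @measurable_fun _ _ (domain Omega) (measurableTypeR R) [set: domain Omega] u.
  exact: Lfun_measurable hu.
pose m : {mfun domain Omega >-> measurableTypeR R} := 
  @mfun_Sub _ _ (domain Omega) (measurableTypeR R) u (mem_set um).
pose q : {mfun_ mu, domain Omega >-> measurableTypeR R} := \pi_({mfun_ mu, domain Omega >-> measurableTypeR R})%qT m.
have qu : \forall x \ae mu, q x = u x.
  have : ae_eq_op mu (repr q) m by apply/eqmodP; rewrite reprK.
  by move/asboolP; apply: filterS => x /(_ I).
have qL2 : (q : domain Omega -> R) \in Lfun mu 2%:E.
  apply: (ae_eq_L2 _ hu).
    exact: (@measurable_funPT _ _ (domain Omega) (measurableTypeR R) (repr q)).
  by apply: filterS qu => x ->.
have qf : finite_norm mu 2%:E (q : domain Omega -> R).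
  by move: qL2; rewrite inE => /andP[_]; rewrite inE.
exists (LebesgueSpace.Pack (LebesgueSpace.Class
  (isFinLebesgue.Axioms_ _ _ _ _ (lee1n 2) q qf))).
exact: qu.
Qed.

End domain_measure.

(** * The spectral fractional power as a multiplier *)

Section fractional_power.
Context {R : realType} {n : nat} {Omega : set 'rV[R]_n.+1}.
Local Notation mu := (lebesgue_on Omega).
Variables (a : 'I_n.+1 -> 'I_n.+1 -> domain Omega -> R).
Variables (lam : nat -> R) (phi : nat -> domain Omega -> R) (s : R).
Hypothesis eig : eigenbasis a lam phi.
Hypothesis s0 : 0 < s.
Implicit Types (u v w : domain Omega -> R).

Lemma eigenbasis_hilbert : hilbert_basis mu phi.
Proof.
have [LDphi ortho expand _] := eig.
have hphi k : phi k \in Lfun mu 2%:E by have [[[]]] := LDphi k.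
split => // u hu e; apply/L2norm_cvg0; last exact: expand.
move=> m; apply: L2B => //.
by apply: L2_sum => k; exact: L2Z.
Qed.

Let basis := eigenbasis_hilbert.

Definition weight k := lam k `^ (s / 2).

Let lam_gt0 k : 0 < lam k. Proof. by have [_ _ _ []] := eig. Qed.

Lemma weight_gt0 k : 0 < weight k.
Proof. exact: powR_gt0. Qed.

Lemma weight_nd : {homo weight : j k / (j <= k)%N >-> j <= k}.
Proof.
have [_ _ _ [_ lam_nd _]] := eig.
by move=> j k jk; apply: ge0_ler_powR; rewrite ?nnegrE ?lam_nd ?divr_ge0 // ltW.
Qed.

Lemma weight_sqr k : weight k ^+ 2 = lam k `^ s.
Proof. by rewrite /weight -powR_mulrn ?powR_ge0 // -powRrM divfK. Qed.

Lemma weight_unbounded M : exists k, M <= weight k.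
Proof.
have [_ _ _ [_ _ lamoo]] := eig.
have /cvgryPge/(_ ((`|M|) `^ (2 / s))) [k _ /(_ k (leqnn k)) kP] := lamoo.
exists k; apply: le_trans (ler_norm M) _.
have -> : `|M| = (`|M| `^ (2 / s)) `^ (s / 2).
  by rewrite -powRrM (_ : 2 / s * (s / 2) = 1) ?powRr1 //; field; rewrite gt_eqF.
by apply: ge0_ler_powR; rewrite ?nnegrE ?powR_ge0 ?divr_ge0 // ltW.
Qed.

Lemma Hspace_multiplier u : Hspace lam phi s u -> exists w, multiplier mu phi weight u w.
Proof.
move=> [hu us].
have us0 k : (0 <= (lam k `^ s * L2dot u (phi k) ^+ 2)%:E)%E.
  by rewrite lee_fin mulr_ge0 ?powR_ge0 ?sqr_ge0.
have [|w hw wc] := riesz_fischer basis (c := fun k => weight k * inner mu u (phi k))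
    (M := fine (\sum_(k <oo) (lam k `^ s * L2dot u (phi k) ^+ 2)%:E)%E).
  move=> m; rewrite -lee_fin fineK; last first.
    by rewrite ge0_fin_numE //; exact: nneseries_ge0.
  apply: le_trans (nneseries_lim_ge m (fun k _ _ => us0 k)).
  rewrite big_mkord sumEFin lee_fin; apply: ler_sum => k _.
  by rewrite exprMn weight_sqr.
by exists w.
Qed.

Lemma multiplier_Hspace u w : multiplier mu phi weight u w -> Hspace lam phi s u.
Proof.
move=> [hu hw uw]; split => //.
apply: (@le_lt_trans _ _ (inner mu w w)%:E); last exact: ltry.
apply: lime_le.
  by apply: is_cvg_nneseries => k _ _; rewrite lee_fin mulr_ge0 ?powR_ge0 ?sqr_ge0.
apply: nearW => m; rewrite big_mkord sumEFin lee_fin.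
apply: le_trans (bessel basis m hw); apply: ler_sum => k _.
by rewrite uw exprMn weight_sqr.
Qed.

(** [LD_power] is a choice among the L^2 sums of a series: [w] shows that one exists, and
    [coef_of_expansion] that every choice has the right coefficients. *)
Lemma LD_power_multiplier u w : multiplier mu phi weight u w ->
  multiplier mu phi weight u (LD_power lam phi (s / 2) u).
Proof.
move=> [hu hw uw]; pose A := [set v | v \in Lfun mu 2%:E /\
    L2norm (fun x =>
        v x - \sum_(k < m) lam k `^ (s / 2) * L2dot u (phi k) * phi k x)
      @[m --> \oo] --> 0%E].
have psumE m : (fun x => \sum_(k < m) lam k `^ (s / 2) * L2dot u (phi k) * phi k x) =
    partial_sum phi (fun k => weight k * inner mu u (phi k)) m by [].
have eL2 v m : v \in Lfun mu 2%:E -> (fun x => v x - \sum_(k < m) lam k `^ (s / 2) * L2dot u (phi k) * phi k x) \in Lfun mu 2%:E.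
  by move=> hv; apply: L2B => //; exact: (psum_L2 basis (fun k => weight k * inner mu u (phi k)) m).
have /(xgetPex (cst 0)) : exists v, A v.
  exists w; split => //; apply/L2norm_cvg0; first by move=> m; exact: eL2.
  have [_ _ /(_ w hw)/=] := basis; rewrite (_ : (fun k => inner mu w (phi k)) =
    (fun k => weight k * inner mu u (phi k))) //.
  by apply/funext => k; rewrite uw.
rewrite -/(LD_power lam phi (s / 2) u) => -[hv /L2norm_cvg0 vc]; split => //.
apply: (coef_of_expansion basis) => //; apply: vc => m.
exact: eL2.
Qed.

End fractional_power.

(** * Correction of the nonlinearity on a null set *)

Section regularized.
Context {R : realType} {n : nat} {Omega : set 'rV[R]_n.+1}.
Local Notation mu := (lebesgue_on Omega).

(** On the exceptional null set [f x] is replaced by the identity, which satisfies all the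
    conditions. *)
Lemma regular_nonlinearity (f : domain Omega -> R -> R) : structural_assumption f ->
  exists g c, odd_nonlinearity g (primitive g) c /\
    \forall x \ae mu, f x = g x.
Proof.
move=> [fae fm [[c1 c2] /= [/andP[c10 c11] _ fc]]].
have [N [mN N0 sN]] : \forall x \ae mu,
    [/\ (forall t, f x (- t) = - f x t) /\ f x 0 = 0,
      {homo f x : r t / r < t}, continuous (f x) &
      forall t, c1 * (t * f x t) <= primitive f x t].
  apply: filterS2 fae fc => x [fodd fnd fcont _] fcx; split => // t.
  by have [/andP[]] := fcx t.
have fN x : ~ N x -> [/\ (forall t, f x (- t) = - f x t) /\ f x 0 = 0,
      {homo f x : r t / r < t}, continuous (f x) &
      forall t, c1 * (t * f x t) <= primitive f x t].
  by move=> Nx; apply: contrapT => /sN.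
have [g [gN gN']] : exists g : domain Omega -> R -> R,
    (forall x, ~ N x -> g x = f x) /\ (forall x, N x -> g x = id).
  exists (fun x t => if x \in N then t else f x t).
  by split=> x Nx; apply/funext => t; rewrite ?(memNset Nx) ?(mem_set Nx).
have gcont x : continuous (g x).
  have [Nx|Nx] := pselect (N x); first by rewrite gN' // => t; exact: cvg_id.
  by rewrite gN //; case: (fN x Nx).
have gnd x : {homo g x : r t / r <= t}.
  have [Nx|Nx] := pselect (N x); first by rewrite gN'.
  by rewrite gN //; apply: ltW_homo; case: (fN x Nx).
have godd x t : g x (- t) = - g x t.
  have [Nx|Nx] := pselect (N x); first by rewrite gN'.
  by rewrite gN //; case: (fN x Nx) => -[].
have sub x u v := primitive_subgradient (gcont x) (gnd x) (godd x) u v.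
(* The value [4^-1] serves the identity: the subgradient inequality from [t / 2] to [t] gives a
   primitive of at least [t ^ 2 / 4]. *)
pose c := Num.min c1 4^-1.
have c0 : 0 < c by rewrite lt_min c10 invr_gt0 ltr0n.
have cc1 : c <= c1 by rewrite ge_min lexx.
have c4 : c <= 4^-1 by rewrite ge_min lexx orbT.
have g0 x : g x 0 = 0 by apply/eqP; rewrite -eqNr -godd oppr0.
have p0 x : primitive g x 0 = 0.
  by rewrite /primitive normr0 set_itv1 Rintegral_set1.
have tg x t : 0 <= t * g x t.
  have [t0|/ltW t0] := leP 0 t.
    by rewrite mulr_ge0 // -(g0 x) gnd.
  by rewrite mulr_le0 // -(g0 x) gnd.
have fg : \forall x \ae mu, f x = g x.
  by exists N; split => // x nx; apply: contrapT => Nx; apply: nx; rewrite /= gN.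
exists g, c; split; last exact: fg.
split; [exact: gcont|exact: gnd|exact: godd| |exact: p0| |exact: sub| |].
- move=> t; apply: (measurable_ae lebesgue_on_complete _ (fm t)).
  by apply: filterS fg => x ->.
- by move=> x t; rewrite /primitive normrN.
- by rewrite c0 (le_trans cc1).
- move=> x t; have [Nx|Nx] := pselect (N x).
    have := sub x (2^-1 * t) t; have := sub x 0 (2^-1 * t).
    rewrite -!/(primitive g x _) p0 gN' //.
    have : c * (t * t) <= 4^-1 * (t * t) by rewrite ler_wpM2r // -expr2 sqr_ge0.
    by lra.
  apply: le_trans (_ : c1 * (t * g x t) <= _); first by rewrite ler_wpM2r.
  by rewrite /primitive gN //; case: (fN x Nx).
Qed.
End regularized.

Section Lfun_infty.
Context d (T : measurableType d) (R : realType).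
Variable mu : {measure set T -> \bar R}.
Implicit Types u v : T -> R.

Lemma Lfun_infty_bounded v : v \in Lfun mu +oo%E ->
  exists2 M : R, 0 <= M & \forall x \ae mu, `|v x| <= M.
Proof.
rewrite inE => /andP[_]; rewrite inE /= /finite_norm unlock.
case: ifPn => [_ vy|mu0 _].
  have [M MP] : exists M, \forall x \ae mu, `|v x| <= M.
    exact: (@ess_supr_bounded _ _ _ mu (fun x => `|v x|) vy).
  exists `|M| => //; apply: filterS MP => x /le_trans; apply; exact: ler_norm.
(* Here the whole space is a null set, and any bound holds almost everywhere. *)
exists 0 => //; exists [set: T]; split => //.
by apply/eqP; rewrite eq_le measure_ge0 andbT leNgt.
Qed.

Lemma bounded_Lfun_infty v M : measurable_fun [set: T] v ->
  (\forall x \ae mu, `|v x| <= M) -> v \in Lfun mu +oo%E.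
Proof.
move=> vm vM; rewrite inE; apply/andP; split; rewrite inE //= /finite_norm unlock.
case: ifPn => // _; apply: (@le_lt_trans _ _ M%:E); last exact: ltry.
by apply/ess_supP; apply: filterS vM => x /=; rewrite lee_fin.
Qed.

Lemma inner_le_ae u v : u \in Lfun mu 2%:E -> v \in Lfun mu 2%:E ->
  (\forall x \ae mu, `|u x| <= `|v x|) -> inner mu u u <= inner mu v v.
Proof.
move=> hu hv uv; rewrite -lee_fin -!EFin_inner //.
apply: ae_ge0_le_integral => //.
- by move=> x _; rewrite lee_fin -expr2 sqr_ge0.
- exact: measurable_int (integrable_mul hu hu).
- by move=> x _; rewrite lee_fin -expr2 sqr_ge0.
- exact: measurable_int (integrable_mul hv hv).
apply: filterS uv => x uvx _; rewrite lee_fin -!expr2.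
by rewrite -(real_normK (num_real (u x))) -(real_normK (num_real (v x))) lerXn2r ?nnegrE.
Qed.

End Lfun_infty.

Lemma L2dot_inner {R : realType} {n : nat} {Omega : set 'rV[R]_n.+1}
  (u v : domain Omega -> R) : L2dot u v = inner (lebesgue_on Omega) u v.
Proof. by []. Qed.

(** * Weak solutions in the original and in the spectral formulation *)

Section weak_solution_link.
Context {R : realType} {n : nat} {Omega : set 'rV[R]_n.+1}.
Local Notation mu := (lebesgue_on Omega).
Variables (a : 'I_n.+1 -> 'I_n.+1 -> domain Omega -> R).
Variables (lam : nat -> R) (phi : nat -> domain Omega -> R) (s : R).
Hypothesis eig : eigenbasis a lam phi.
Hypothesis s0 : 0 < s.
Variables (f g : domain Omega -> R -> R) (c : R).
Hypothesis nl : odd_nonlinearity g (primitive g) c.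
Hypothesis fg : \forall x \ae mu, f x = g x.
Implicit Types (u v w z : domain Omega -> R).

Let basis := eigenbasis_hilbert eig.
Local Notation wt := (weight lam s).
Local Notation finite_energy := (finite_energy mu phi wt (primitive g)).
Local Notation weak_sol := (weak_sol mu phi wt g (primitive g)).
Local Notation pow := (LD_power lam phi (s / 2)).

Let primitive_ae u :
  \forall x \ae mu, primitive g x (u x) = primitive f x (u x).
Proof. by apply: filterS fg => x fgx; rewrite /primitive fgx. Qed.

Let wt_gt0 k : 0 < wt k. Proof. exact: (weight_gt0 _ eig). Qed.

Lemma V0_finite_energy u : V0 lam phi s f u -> finite_energy u (pow u).
Proof.
move=> [/(Hspace_multiplier eig)[w uw] iu]; split.
  exact: (LD_power_multiplier eig uw).
apply: integrable_ae_eq iu; first exact: lebesgue_on_complete.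
by apply: filterS (primitive_ae u) => x ->.
Qed.

Lemma finite_energy_V0 u w : finite_energy u w ->
  V0 lam phi s f u /\ \forall x \ae mu, pow u x = w x.
Proof.
move=> [uw iu]; split; first split.
- exact: (multiplier_Hspace eig uw).
- by apply: integrable_ae_eq iu; [exact: lebesgue_on_complete|exact: primitive_ae].
have [_ hp pc] := LD_power_multiplier eig uw; have [_ hw wc] := uw.
by apply: (coef_ae_eq basis) => // k; rewrite pc wc.
Qed.

Let f_mul_ae u v : measurable_fun [set: domain Omega] u ->
  measurable_fun [set: domain Omega] v ->
  \int[mu]_x (g x (u x) * v x) = \int[mu]_x (f x (u x) * v x).
Proof.
move=> um vm; have gm := measurable_funM (measurable_nl nl um) vm.
apply: (Rintegral_ae_eq lebesgue_on_complete _ gm).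
by apply: filterS fg => x ->.
Qed.

Lemma weak_solution_weak_sol z u : weak_solution lam phi s f z u ->
  weak_sol z u (pow u).
Proof.
move=> [/V0_finite_energy hu us]; split => // v q hv.
have [Vv pq] := finite_energy_V0 hv.
have [[hu2 hpu _] _] := hu; have [[hv2 hq _] _] := hv.
have [[_ hpv _] _] := V0_finite_energy Vv.
have um := Lfun_measurable hu2; have vm := Lfun_measurable hv2.
rewrite (innerC _ _ q) -(eq_inner_ael hpv hq hpu pq) (innerC _ _ (pow u)).
rewrite (f_mul_ae um vm); exact: (us v Vv).
Qed.

Lemma weak_sol_weak_solution z u w : weak_sol z u w ->
  weak_solution lam phi s f z u.
Proof.
move=> [hu us]; have [Vu pw] := finite_energy_V0 hu; split => // v Vv.
have hv := V0_finite_energy Vv.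
have [[hu2 hw _] _] := hu; have [[hv2 hpv _] _] := hv.
have [[_ hpu _] _] := V0_finite_energy Vu.
have um := Lfun_measurable hu2; have vm := Lfun_measurable hv2.
by rewrite !L2dot_inner -(f_mul_ae um vm) (eq_inner_ael hpu hw hpv pw) (us _ _ hv).
Qed.

Lemma weak_sol_ae z u u' w : u' \in Lfun mu 2%:E -> (\forall x \ae mu, u x = u' x) ->
  weak_sol z u w -> weak_sol z u' w.
Proof.
move=> hu' uu [[[hu hw uw] iu] us].
have um := Lfun_measurable hu.
have [hphi _ _] := basis.
split.
  split; first split => // k.
    by rewrite uw (eq_inner_ael hu hu' (hphi k) uu).
  apply: integrable_ae_eq iu; first exact: lebesgue_on_complete.
  by apply: filterS uu => x ->.
move=> v q hv; rewrite -(us v q hv).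
have gm : measurable_fun [set: domain Omega] (fun x => g x (u x) * v x) :=
  measurable_funM (measurable_nl nl um) (finite_energy_measurable hv).
have E : \int[mu]_x (g x (u x) * v x) = \int[mu]_x (g x (u' x) * v x).
  apply: (Rintegral_ae_eq lebesgue_on_complete _ gm).
  by apply: filterS uu => x uux; rewrite uux.
by rewrite E.
Qed.

(** The function found by [weak_sol_exists] still solves the equation after passing to a class, so
    the set of choices is nonempty and the default [z] plays no part. *)
Lemma solution_map_weak_sol (z : L2 Omega) :
  weak_sol z (solution_map lam phi s f z) (pow (solution_map lam phi s f z)).
Proof.
apply: weak_solution_weak_sol.
have [u [w us]] := weak_sol_exists basis wt_gt0 (weight_nd eig s0) nl (L2_Lfun z).
have hu : u \in Lfun mu 2%:E by case: us => -[[]].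
have [v vu] := L2_class hu.
apply: (@xgetPex _ z [set u : L2 Omega | weak_solution lam phi s f z u]).
exists v; apply: (@weak_sol_weak_solution _ _ w); apply: weak_sol_ae us.
  exact: L2_Lfun.
by apply: filterS vu => x ->.
Qed.

End weak_solution_link.

(** * The minimization problem *)

(** The limit is the supremum of the levels [t] with [t <= h] on a set of [U]; above it the
    complementary set belongs to [U]. *)
Lemma ultrafilter_bounded_lim {X : Type} {R : realType} (U : set_system X)
    (h : X -> R) (K : R) : UltraFilter U -> U [set x | `|h x| <= K] ->
  exists l : R, forall e, 0 < e -> U [set x | `|h x - l| < e].
Proof.
move=> UU UK; pose S := [set t : R | U [set x | t <= h x]].
have supS : has_sup S.
  split; first by exists (- K); apply: filterS UK => x /=; rewrite ler_norml => /andP[].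
  exists K => t St; have [x /= [tx]] := filter_ex (filterI St UK).
  by rewrite ler_norml => /andP[_]; exact: le_trans.
exists (sup S) => e e0.
have [t St te] := sup_adherent e0 supS.
have : ~ S (sup S + e / 2).
  move=> /(ub_le_sup supS.2); rewrite gerDl leNgt => /negP; apply.
  by rewrite divr_gt0.
move=> nS; have UC : U (~` [set x | sup S + e / 2 <= h x]).
  by have [] := @in_ultra_setVsetC _ U [set x | sup S + e / 2 <= h x] UU.
apply: filterS2 St UC => x /= tx /negP; rewrite -ltNge => xs.
by rewrite ltr_distl; lra.
Qed.

Section minimization.
Context {R : realType} {n : nat} {Omega : set 'rV[R]_n.+1}.
Local Notation mu := (lebesgue_on Omega).
Hypothesis boundedO : bounded_set Omega.
Variables (za zb : domain Omega -> R).
Hypothesis zaLoo : za \in Lfun mu +oo%E.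
Hypothesis zbLoo : zb \in Lfun mu +oo%E.
Hypothesis zab : \forall x \ae mu, za x <= zb x.

Lemma Lfun_infty_L2 u : u \in Lfun mu +oo%E -> u \in Lfun mu 2%:E.
Proof.
exact: (@Lfun_subset _ _ _ mu 2%:E +oo%E (lee1n 2) (leey 1) (lebesgue_on_fin boundedO) (leey _)).
Qed.

(** A function between [za] and [zb] is bounded by a constant, which is square integrable because
    [Omega] has finite measure. *)
Lemma admissible_bound : exists K : R, forall z : domain Omega -> R,
  z \in Lfun mu 2%:E -> (\forall x \ae mu, za x <= z x <= zb x) ->
  z \in Lfun mu +oo%E /\ inner mu z z <= K.
Proof.
have [Ma Ma0 aM] := Lfun_infty_bounded zaLoo.
have [Mb Mb0 bM] := Lfun_infty_bounded zbLoo.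
have cL2 : cst (Ma + Mb) \in Lfun mu 2%:E.
  apply: Lfun_infty_L2; apply: (@bounded_Lfun_infty _ _ _ _ _ `|Ma + Mb|) => //.
  exact: nearW.
exists (inner mu (cst (Ma + Mb)) (cst (Ma + Mb))) => z hz azb.
have zM : \forall x \ae mu, `|z x| <= Ma + Mb.
  near=> x.
  have : `|za x| <= Ma by near: x.
  have : `|zb x| <= Mb by near: x.
  have /andP[] : za x <= z x <= zb x by near: x.
  by rewrite !ler_norml => ? ? /andP[? ?] /andP[? ?]; apply/andP; split; lra.
split; first exact: bounded_Lfun_infty (Lfun_measurable hz) zM.
apply: inner_le_ae => //; apply: filterS zM => x /= /le_trans; apply.
exact: ler_norm.
Unshelve. all: by end_near. Qed.

Lemma admissible_nonempty : exists z : L2 Omega, admissible za zb z.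
Proof.
have zaL2 := Lfun_infty_L2 zaLoo.
have [z zE] := L2_class zaL2.
have azb : \forall x \ae mu, za x <= z x <= zb x.
  by apply: filterS2 zE zab => x -> ->; rewrite lexx.
exists z; split => //.
by have [K /(_ _ (L2_Lfun z) azb)[]] := admissible_bound.
Qed.

Lemma lower_semicontinuous_seq (J : L2 Omega -> \bar R) (v : nat -> L2 Omega)
    (u : L2 Omega) (b : R) : lower_semicontinuous J ->
  inner mu (fun x => v k x - u x) (fun x => v k x - u x) @[k --> \oo] --> 0 ->
  (forall k, J (v k) <= b%:E)%E -> (J u <= b%:E)%E.
Proof.
move=> lsc vu vb; rewrite leNgt; apply/negP => /lsc[V [e /= e0 eV] JV].
have hvu k : (fun x => v k x - u x) \in Lfun mu 2%:E by apply: L2B; exact: L2_Lfun.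
have /(L2norm_cvg0 hvu) := vu; move/fine_cvg/cvgrPdist_lt/(_ e e0) => [N _ /(_ N (leqnn N))].
rewrite sub0r normrN => Ne.
have /eV/JV : L2ball u e (v N).
  move: Ne; rewrite /L2ball /= /L2norm (L2norm_inner (hvu N)) /= ger0_norm ?sqrtr_ge0 //.
by rewrite ltNge vb.
Qed.

Lemma L2ball_inner (u v : L2 Omega) (e : R) : 0 < e ->
  inner mu (fun x => v x - u x) (fun x => v x - u x) < e ^+ 2 -> L2ball u e v.
Proof.
move=> e0 h; have hvu : (fun x => v x - u x) \in Lfun mu 2%:E by apply: L2B; exact: L2_Lfun.
rewrite /L2ball /= /L2norm (L2norm_inner hvu) lte_fin.
by rewrite -(ger0_norm (ltW e0)) -sqrtr_sqr ltr_sqrt ?exprn_gt0.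
Qed.

(** Convexity is stated for combinations given almost everywhere; [t = 1] is enough. *)
Lemma convex_functional_ae (J : L2 Omega -> \bar R) (u v : L2 Omega) :
  convex_functional J -> (\forall x \ae mu, v x = u x) -> (J v <= J u)%E.
Proof.
move=> Jc vu; have := Jc u u v 1.
rewrite lexx ler01 => /(_ isT); rewrite subrr mul1e mul0e adde0; apply.
by apply: filterS vu => x ->; rewrite mul1r mul0r addr0.
Qed.

End minimization.

(** * Weak limits of admissible controls *)

Section weak_limit.
Context {R : realType} {n : nat} {Omega : set 'rV[R]_n.+1}.
Local Notation mu := (lebesgue_on Omega).
Hypothesis boundedO : bounded_set Omega.
Variables (za zb : domain Omega -> R).
Hypothesis zaLoo : za \in Lfun mu +oo%E.
Hypothesis zbLoo : zb \in Lfun mu +oo%E.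
Variable phi : nat -> domain Omega -> R.
Hypothesis basis : hilbert_basis mu phi.
Variable J : L2 Omega -> \bar R.
Hypothesis Jconvex : convex_functional J.
Hypothesis Jlsc : lower_semicontinuous J.
Variable U : set_system (L2 Omega).
Hypothesis UU : ProperFilter U.
Hypothesis Uadm : U (admissible za zb).
Variables (zeta : nat -> R) (beta : R).
Hypothesis Uzeta : forall k e, 0 < e ->
  U [set z : L2 Omega | `|inner mu z (phi k) - zeta k| < e].
Hypothesis Ubeta : forall e, 0 < e -> U [set z | (J z < (beta + e)%:E)%E].

Let hphi k : phi k \in Lfun mu 2%:E. Proof. by case: basis. Qed.

Let eps (m : nat) : R := m.+1%:R^-1.
Let eps_gt0 m : 0 < eps m. Proof. by rewrite invr_gt0 ltr0n. Qed.
Let eps_nd m l : (m <= l)%N -> eps l <= eps m.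
Proof. by move=> ml; rewrite lef_pV2 ?posrE ?ltr0n // ler_nat. Qed.

(** [nested_convex_inter] works with functions, so [J] is evaluated at an almost everywhere equal
    class. Non-strict inequalities keep the sets closed. *)
Let C (m : nat) : set (domain Omega -> R) := [set w | [/\ w \in Lfun mu 2%:E,
  \forall x \ae mu, za x <= w x <= zb x,
  forall k, (k < m)%N -> `|inner mu w (phi k) - zeta k| <= eps m &
  exists2 v : L2 Omega, (\forall x \ae mu, v x = w x) &
    (J v <= (beta + eps m)%:E)%E]].

Let C_nonempty m : C m !=set0.
Proof.
have Uz : U [set z : L2 Omega |
    forall k : 'I_m, `|inner mu z (phi k) - zeta k| < eps m].
  by apply: filter_forall => k; exact: Uzeta.
have [z [[/= [_ azb] zz] zJ]] := filter_ex (filterI (filterI Uadm Uz) (Ubeta (eps_gt0 m))).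
exists z; split; [exact: L2_Lfun|exact: azb| |].
  by move=> k km; have /ltW := zz (Ordinal km).
by exists z; [exact: nearW|exact: ltW].
Qed.

Let C_le m l : (m <= l)%N -> C l `<=` C m.
Proof.
move=> ml w [hw azb wz [v vw vJ]]; split => //.
  move=> k km; apply: le_trans (eps_nd ml); apply: wz.
  exact: leq_trans km ml.
by exists v => //; apply: le_trans vJ _; rewrite lee_fin lerD2l eps_nd.
Qed.

Let C_mid m u v : C m u -> C m v -> C m (fun x => 2^-1 * (u x + v x)).
Proof.
move=> [hu au uz [u' uu' uJ]] [hv av vz [v' vv' vJ]].
have hm : (fun x => 2^-1 * (u x + v x)) \in Lfun mu 2%:E by rewrite L2Z // L2D.
split => //.
- apply: filterS2 au av => x /andP[? ?] /andP[? ?]; apply/andP; split; lra.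
- move=> k km; rewrite innerZl ?L2D // innerDl //.
  have := uz k km; have := vz k km; rewrite !ler_distl => /andP[? ?] /andP[? ?].
  by apply/andP; split; lra.
have [w' ww'] := L2_class hm; exists w' => //.
have t01 : 0 <= (2^-1 : R) <= 1 by apply/andP; split; lra.
apply: le_trans (Jconvex t01 (_ : \forall x \ae mu, w' x = 2^-1 * u' x + (1 - 2^-1) * v' x)) _.
  near=> x.
  have -> : w' x = 2^-1 * (u x + v x) by near: x.
  have -> : u' x = u x by near: x.
  have -> : v' x = v x by near: x.
  by field.
have -> : (1 - 2^-1 : R) = 2^-1 by field.
have -> : (beta + eps m)%:E = (2^-1%:E * (beta + eps m)%:E + 2^-1%:E * (beta + eps m)%:E)%E.
  by rewrite -!EFinM -EFinD; congr EFin; field.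
by apply: leeD; apply: lee_wpmul2l => //; rewrite lee_fin.
Unshelve. all: by end_near. Qed.

Let C_closed m (v : nat -> domain Omega -> R) u : (forall k, C m (v k)) ->
  u \in Lfun mu 2%:E ->
  inner mu (fun x => v k x - u x) (fun x => v k x - u x) @[k --> \oo] --> 0 ->
  C m u.
Proof.
move=> vC hu vu.
have hv k : v k \in Lfun mu 2%:E by case: (vC k).
split => //.
- have [r _ ru] := cvg_subsequence_ae hv hu vu.
  have av : \forall x \ae mu, forall k, za x <= v k x <= zb x.
    by apply/ae_foralln => k; case: (vC k).
  apply: filterS2 av ru => x ax rx; rewrite -(cvg_lim _ rx) //; apply/andP; split.
    apply: limr_ge; first by apply/cvg_ex; eexists; exact: rx.
    by apply: nearW => k; case/andP: (ax (r k)).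
  apply: limr_le; first by apply/cvg_ex; eexists; exact: rx.
  by apply: nearW => k; case/andP: (ax (r k)).
- move=> k km.
  have l : `|inner mu (v j) (phi k) - zeta k| @[j --> \oo] --> `|inner mu u (phi k) - zeta k|.
    by apply: cvg_norm; apply: cvgB; [exact: cvg_inner|exact: cvg_cst].
  rewrite -(cvg_lim _ l) //; apply: limr_le; first by apply/cvg_ex; eexists; exact: l.
  by apply: nearW => j; case: (vC j) => _ _ + _; apply.
have [u' uu'] := L2_class hu; exists u' => //.
have /choice[v' v'P] k : exists v' : L2 Omega, (\forall x \ae mu, v' x = v k x) /\
    (J v' <= (beta + eps m)%:E)%E.
  by have [_ _ _ [v' ? ?]] := vC k; exists v'.
apply: (lower_semicontinuous_seq Jlsc (v := v')) => [|k]; last by case: (v'P k).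
have -> : (fun k => inner mu (fun x => v' k x - u' x) (fun x => v' k x - u' x)) =
    (fun k => inner mu (fun x => v k x - u x) (fun x => v k x - u x)).
  apply/funext => k; have [vk _] := v'P k.
  have h1 : (fun x => v' k x - u' x) \in Lfun mu 2%:E by apply: L2B; exact: L2_Lfun.
  have h2 : (fun x => v k x - u x) \in Lfun mu 2%:E by exact: L2B.
  have h : \forall x \ae mu, v' k x - u' x = v k x - u x.
    by apply: filterS2 vk uu' => x -> ->.
  exact: (eq_inner_ae h1 h2 h1 h2 h h).
exact: vu.
Qed.

Lemma weak_limit_exists : exists z : L2 Omega, [/\ admissible za zb z,
  forall k, inner mu z (phi k) = zeta k & (J z <= beta%:E)%E].
Proof.
have [K KP] := admissible_bound boundedO zaLoo zbLoo.
have [||||||w wC] := @nested_convex_inter _ _ _ mu C K.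
- by move=> m u [].
- exact: C_nonempty.
- exact: C_le.
- by move=> u [hu au _ _]; have [] := KP u hu au.
- exact: C_mid.
- exact: C_closed.
have [hw aw _ _] := wC 0%N.
have [z zw] := L2_class hw; exists z.
have hz := L2_Lfun z.
have az : \forall x \ae mu, za x <= z x <= zb x.
  by apply: filterS2 aw zw => x + ->.
have eps0 : eps m @[m --> \oo] --> 0 by exact: cvg_harmonic.
split.
- by split => //; have [] := KP z hz az.
- move=> k; rewrite (eq_inner_ael hz hw (hphi k) zw).
  apply/eqP; rewrite -subr_eq0 -normr_le0.
  rewrite -(cvg_lim _ eps0) //; apply: limr_ge; first by apply/cvg_ex; eexists; exact: eps0.
  exists k.+1 => // m /= km.
  by have [_ _ + _] := wC m; apply.
have Jz m : (J z <= (beta + eps m)%:E)%E.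
  have [_ _ _ [v vw vJ]] := wC m; apply: le_trans vJ.
  apply: convex_functional_ae => //.
  by apply: filterS2 zw vw => x -> ->.
apply/lee_addgt0Pr => e e0.
have /cvgrPdist_lt/(_ e e0)[N _ /(_ N (leqnn N))] := eps0.
rewrite sub0r normrN gtr0_norm // => Ne.
by apply: le_trans (Jz N) _; rewrite -EFinD lee_fin lerD2l ltW.
Qed.

End weak_limit.

(** * Weak-to-strong continuity of the control-to-state map *)

Section solution_map_continuity.
Context {R : realType} {n : nat} {Omega : set 'rV[R]_n.+1}.
Local Notation mu := (lebesgue_on Omega).
Variables (a : 'I_n.+1 -> 'I_n.+1 -> domain Omega -> R).
Variables (lam : nat -> R) (phi : nat -> domain Omega -> R) (s : R).
Hypothesis eig : eigenbasis a lam phi.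
Hypothesis s0 : 0 < s.
Variable f : domain Omega -> R -> R.
Hypothesis fA : structural_assumption f.
Variables (U : set_system (L2 Omega)) (K : R) (V : L2 Omega).
Hypothesis UU : ProperFilter U.
Hypothesis UK : U [set z : L2 Omega | inner mu z z <= K].
Hypothesis Uweak : forall k e, 0 < e ->
  U [set z : L2 Omega | `|inner mu z (phi k) - inner mu V (phi k)| < e].
Local Notation S := (solution_map lam phi s f).

(* Weak convergence of the right-hand sides is enough: in the stability    *)
(* estimate [weak_sol_dual_bound] the first term is small for N large, and *)
(* the second one only involves finitely many coefficients.                *)
Lemma solution_map_continuous e : 0 < e -> U [set z | L2ball (S V) e (S z)].
Proof.
move=> e0; have quarters (t : R) : 0 < t -> t / 4 + t / 4 < t by lra.
have [g [c [nl fg]]] := regular_nonlinearity fA.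
have basis := eigenbasis_hilbert eig.
have wt_gt0 k : 0 < weight lam s k by exact: (weight_gt0 _ eig).
have wt_nd := weight_nd eig s0.
have sol := solution_map_weak_sol eig s0 nl fg.
set wt := weight lam s in wt_gt0 wt_nd sol.
pose L := 2 * K + 2 * inner mu V V.
(* Each of the two terms will be at most [h], and their sum [wt 0 * e / 2] is strictly below
   [wt 0 * e]. *)
pose h := wt 0%N * e / 4.
have h0 : 0 < h by rewrite divr_gt0 // mulr_gt0.
have [N NP] := weight_unbounded eig s0 (Num.sqrt L / h).
(* [N] differences below [d] sum to at most [h * wt 0]; [N.+1] avoids a division by 0. *)
pose d := h * wt 0%N / N.+1%:R.
have d0 : 0 < d by rewrite divr_gt0 ?ltr0n // mulr_gt0.
have Ud : U [set z : L2 Omega |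
    forall k : 'I_N, `|inner mu z (phi k) - inner mu V (phi k)| < d].
  by apply: filter_forall => k; exact: Uweak.
apply: filterS2 UK Ud => z /= zK zd.
have hz := L2_Lfun z; have hV := L2_Lfun V.
have hSz := L2_Lfun (S z); have hSV := L2_Lfun (S V).
apply: L2ball_inner => //.
have B := weak_sol_dual_bound basis wt_gt0 wt_nd nl N hz hV (sol z) (sol V).
rewrite -(ltr_pM2l (exprn_gt0 2 (wt_gt0 0%N))); apply: le_lt_trans B _.
have dzL : inner mu (fun x => z x - V x) (fun x => z x - V x) <= L.
  by apply: le_trans (inner_sub_le hz hV) _; rewrite /L lerD2r ler_wpM2l.
have I1 : Num.sqrt (inner mu (fun x => z x - V x) (fun x => z x - V x)) / wt N <= h.
  rewrite ler_pdivrMr //; apply: le_trans (_ : Num.sqrt L <= _).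
    by rewrite ler_wsqrtr.
  by rewrite mulrC -ler_pdivrMr.
have I2 : (\sum_(k < N) `|inner mu z (phi k) - inner mu V (phi k)|) / wt 0%N <= h.
  rewrite ler_pdivrMr //; apply: le_trans (_ : \sum_(k < N) d <= _).
    by apply: ler_sum => k _; exact/ltW/zd.
  rewrite sumr_const card_ord -mulr_natl /d mulrA ler_pdivrMr ?ltr0n // mulrC.
  by rewrite ler_wpM2l ?ler_nat // mulr_ge0 // ltW.
have I0 : 0 <= Num.sqrt (inner mu (fun x => z x - V x) (fun x => z x - V x)) / wt N.
  by rewrite divr_ge0 ?sqrtr_ge0 // ltW.
have I3 : 0 <= (\sum_(k < N) `|inner mu z (phi k) - inner mu V (phi k)|) / wt 0%N.
  by rewrite divr_ge0 ?sumr_ge0 // ltW.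
have I4 : 0 <= wt 0%N * e by rewrite mulr_ge0 ?(ltW e0) // ltW.
rewrite -exprMn ltr_pXn2r ?nnegrE ?addr_ge0 //.
apply: le_lt_trans (lerD I1 I2) _; exact/quarters/mulr_gt0.
Qed.

End solution_map_continuity.

(** The slack comes in two halves: one for the deviation of [J2] from its limit, one for the excess
    of a near-minimizer over the infimum. *)
Lemma lte_fin_between {R : realType} (x : R) (y : \bar R) : (x%:E < y)%E ->
  exists2 e : R, 0 < e & ((x + 2 * e)%:E < y)%E.
Proof.
case: y => [y||] //; last by exists 1 => //; rewrite ltry.
by rewrite lte_fin => xy; exists ((y - x) / 4); rewrite ?lte_fin; lra.
Qed.

Theorem theorem4p4 (R : realType) (n : nat) (s : R)
  (Omega : set 'rV[R]_n.+1)
  (a : 'I_n.+1 -> 'I_n.+1 -> domain Omega -> R)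
  (lam : nat -> R) (phi : nat -> domain Omega -> R)
  (f : domain Omega -> R -> R) (J1 J2 : L2 Omega -> \bar R)
  (za zb : domain Omega -> R)
  (s01 : 0 < s < 1)
  (openO : open Omega) (boundedO : bounded_set Omega)
  (ella : elliptic_coefficients a) (basis : eigenbasis a lam phi)
  (fA : structural_assumption f) (fgrowth : growth_condition f)
  (fL2 : forall w : domain Omega -> R, w \in Lfun (lebesgue_on Omega) +oo%E ->
    (fun x => f x (w x)) \in Lfun (lebesgue_on Omega) 2%:E)
  (J1ge0 : forall u, (0 <= J1 u)%E)
  (J1proper : proper_functional J1) (J1lsc : lower_semicontinuous J1)
  (J2gtNy : forall u, (-oo < J2 u)%E)
  (J2proper : proper_functional J2) (J2convex : convex_functional J2)
  (J2lsc : lower_semicontinuous J2)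
  (J2bounded : exists m : R, forall u, (m%:E <= J2 u)%E)
  (zaLoo : za \in Lfun (lebesgue_on Omega) +oo%E)
  (zbLoo : zb \in Lfun (lebesgue_on Omega) +oo%E)
  (zab : \forall x \ae lebesgue_on Omega, za x <= zb x) :
  exists2 z : L2 Omega, admissible za zb z &
    forall z' : L2 Omega, admissible za zb z' ->
      (J1 (solution_map lam phi s f z) + J2 z <=
       J1 (solution_map lam phi s f z') + J2 z')%E.
Proof.
have /andP[s0 _] := s01.
have hb := eigenbasis_hilbert basis.
have [hphi ortho _] := hb.
pose S := solution_map lam phi s f; rewrite -/S.
pose J z := (J1 (S z) + J2 z)%E.
pose I := ereal_inf [set J z | z in admissible za zb].
have I_le z : admissible za zb z -> (I <= J z)%E.
  by move=> az; apply: ereal_inf_lbound; exists z.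
have [z0 az0] := admissible_nonempty boundedO zaLoo zbLoo zab.
have [m mJ2] := J2bounded.
have mJ z : (m%:E <= J z)%E by rewrite -[m%:E]add0e; exact: leeD.
have mI : (m%:E <= I)%E by apply: le_ereal_inf_tmp => _ [z _ <-].
(* If the infimum is infinite, every admissible control is a minimizer. *)
have [Iy|] := eqVneq I +oo%E.
  exists z0 => // z' az'; rewrite -/(J z').
  by have := I_le z' az'; rewrite Iy leye_eq => /eqP ->; rewrite leey.
move: mI; case EI : I => [r||] // _ _.
pose base (e : R) := [set z | admissible za zb z /\ (J z < (r + e)%:E)%E].
pose F : set_system (L2 Omega) := filter_from [set e : R | 0 < e] base.
have FF : ProperFilter F.
  apply: filter_from_proper; last first.
    move=> e /= e0; have Ifin : ereal_inf [set J z | z in admissible za zb] \is a fin_num.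
      by rewrite -/I EI.
    have [_ [z az <-]] := lb_ereal_inf_adherent e0 Ifin.
    by rewrite -/I EI => zJ; exists z.
  apply: filter_from_filter; first by exists 1 => /=.
  move=> d e /= d0 e0; exists (Num.min d e); first by rewrite /= lt_min d0.
  move=> z [az zJ]; split; split => //; apply: lt_le_trans zJ _;
    by rewrite lee_fin lerD2l ge_min lexx ?orbT.
(* Along an ultrafilter every bounded real quantity converges, so all coefficients and [J2] have
   limits at once, without a diagonal subsequence. *)
have [U [UU FU]] := ultraFilterLemma FF.
have Ubase e : 0 < e -> U (base e) by move=> e0; apply: FU; exists e.
have Uadm : U (admissible za zb) by apply: filterS (Ubase 1 ltr01) => z [].
have [K KP] := admissible_bound boundedO zaLoo zbLoo.
have UK : U [set z : L2 Omega | inner (lebesgue_on Omega) z z <= K].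
  by apply: filterS Uadm => z [_ azb]; have [] := KP z (L2_Lfun z) azb.
have /choice[zeta zetaP] k : exists l : R, forall e, 0 < e ->
    U [set z : L2 Omega | `|inner (lebesgue_on Omega) z (phi k) - l| < e].
  apply: (@ultrafilter_bounded_lim _ _ U _ (Num.sqrt K)) => //.
  apply: filterS UK => z zK /=.
  apply: le_trans (inner_le_sqrt (L2_Lfun z) (hphi k)) _.
  by rewrite ortho eqxx sqrtr1 mulr1 ler_wsqrtr.
have J2J z : (J2 z <= J z)%E by rewrite -[leLHS]add0e; exact: leeD.
have J2fin z e : base e z -> (J2 z = (fine (J2 z))%:E).
  move=> [_ zJ]; rewrite fineK // fin_numElt (lt_le_trans _ (mJ2 z)) ?ltNyr //=.
  by apply: le_lt_trans (J2J z) _; apply: lt_trans zJ _; rewrite ltry.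
have [beta betaP] : exists l : R, forall e, 0 < e ->
    U [set z : L2 Omega | `|fine (J2 z) - l| < e].
  (* Since [J1] is nonnegative, [J2] lies between [m] and [r + 1] on near-minimizers. *)
  apply: (@ultrafilter_bounded_lim _ _ U _ (`|m| + `|r + 1|)) => //.
  apply: filterS (Ubase 1 ltr01) => z zB /=.
  have zf := J2fin _ _ zB; have [_ zJ] := zB.
  have : (m%:E <= (fine (J2 z))%:E)%E by rewrite -zf.
  have : ((fine (J2 z))%:E < (r + 1)%:E)%E by rewrite -zf; exact: le_lt_trans (J2J z) zJ.
  rewrite lee_fin lte_fin => ? ?.
  have := ler_norm (r + 1); have := ler_norm (- m); rewrite normrN => ? ?.
  have := normr_ge0 m; have := normr_ge0 (r + 1) => ? ?.
  by rewrite ler_norml; apply/andP; split; lra.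
have Ubeta e : 0 < e -> U [set z | (J2 z < (beta + e)%:E)%E].
  move=> e0; apply: filterS2 (betaP e e0) (Ubase e e0) => z /= zb' zB.
  by rewrite (J2fin _ _ zB) lte_fin; move: zb'; rewrite ltr_distl => /andP[].
have [V [aV Vzeta VJ2]] := weak_limit_exists boundedO zaLoo zbLoo hb J2convex
  J2lsc (@ultra_proper _ U UU) Uadm zetaP Ubeta.
exists V => // z' az'; rewrite -/(J z'); apply: le_trans (I_le z' az'); rewrite EI.
(* It remains to bound [J1 (S V)] by [r - beta]. Otherwise some near-minimizer [z] with
   [J z < r + e] has [J1 (S z) > r - beta + 2 * e] and [J2 z > beta - e], whose sum contradicts the
   choice of [z]. *)
have -> : r%:E = ((r - beta)%:E + beta%:E)%E by rewrite -EFinD subrK.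
apply: leeD => //; rewrite leNgt; apply/negP => /lte_fin_between[e e0].
move=> /J1lsc[W [d /= d0 dW] WJ].
have UV k e' : 0 < e' -> U [set z : L2 Omega |
    `|inner (lebesgue_on Omega) z (phi k) - inner (lebesgue_on Omega) V (phi k)| < e'].
  by rewrite Vzeta; exact: zetaP.
have UW := solution_map_continuous basis s0 fA (@ultra_proper _ U UU) UK UV d0.
have [z [[/= /dW/WJ zJ1 zbeta] zB]] := filter_ex (filterI (filterI UW (betaP e e0)) (Ubase e e0)).
have := zB.2; rewrite ltNge => /negP; apply.
apply: le_trans (_ : ((r - beta + 2 * e)%:E + (beta - e)%:E <= _)%E).
  by rewrite -EFinD lee_fin; lra.
apply: leeD; first exact: ltW.
by rewrite (J2fin _ _ zB) lee_fin; move: zbeta; rewrite ltr_distl => /andP[/ltW].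
Qed.
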